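(* Let $G$ be a finite simple graph with maximum degree $\Delta(G)\geq 17$ and maximum average degree $\mathrm{mad}(G)<3$. Then $G$ admits a list $2$-distance $(\Delta(G)+2)$-coloring, i.e. for every assignment of a list $L(v)$ of $\Delta(G)+2$ colors to each vertex $v$, there is a choice of colors $c(v)\in L(v)$ such that any two distinct vertices that are adjacent or have a common neighbor receive distinct colors.
   Context: All graphs are finite and simple. The average degree of a graph $H$ is $2|E(H)|/|V(H)|$; the maximum average degree $\mathrm{mad}(G)$ is the maximum of the average degree over all (nonempty) subgraphs $H$ of $G$. *)

(* Defs.v *)
From mathcomp Require Import all_boot all_order all_algebra.

Set Implicit Arguments.
Unset Strict Implicit.
Unset Printing Implicit Defensive.

Import Order.TTheory GRing.Theory Num.Theory.

Record sgraph := SGraph {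
  vertex :> finType;
  adj : rel vertex;
  adj_sym : symmetric adj;
  adj_irr : irreflexive adj
}.

Definition edges (G : sgraph) : {set {set G}} :=
  [set [set p.1; p.2] | p : G * G & adj p.1 p.2].

Definition degree (G : sgraph) (v : G) : nat := #|[set w | adj v w]|.

Definition max_degree (G : sgraph) : nat := \max_(v : G) degree v.

(* A pair H = (vertex set, edge set) is a subgraph of G; H need not be
   induced. *)
Definition is_subgraph (G : sgraph) (H : {set G} * {set {set G}}) : bool :=
  (H.2 \subset edges G) && [forall f in H.2, f \subset H.1].

Definition avg_degree (G : sgraph) (H : {set G} * {set {set G}}) : rat :=
  ((2 * #|H.2|)%N%:R / #|H.1|%:R)%R.

(* The neutral element 0 of the maximum is harmless: average degrees are
   nonnegative, and 0 is only the outcome for edgeless G (including the graph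
   without vertices, which has no nonempty subgraph). *)
Definition mad (G : sgraph) : rat :=
  \big[Order.max/0%R]_(H : {set G} * {set {set G}}
                       | is_subgraph H && (H.1 != set0)) avg_degree H.

Definition within_distance2 (G : sgraph) (u v : G) : Prop :=
  adj u v \/ exists w : G, adj u w /\ adj w v.

Definition two_distance_coloring (G : sgraph) (C : Type) (c : G -> C) : Prop :=
  forall u v : G, u <> v -> within_distance2 u v -> c u <> c v.

(* Lists are duplicate-free sequences, so that [size (L v)] counts colors. *)
Definition list_two_distance_colorable (G : sgraph) (k : nat) : Prop :=
  forall (C : eqType) (L : G -> seq C),
    (forall v : G, uniq (L v) /\ size (L v) = k) ->
    exists c : G -> C, (forall v : G, c v \in L v) /\ two_distance_coloring c.

(* Main.v *)
Require Import Defs.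
From mathcomp Require Import all_boot all_order all_algebra.
From mathcomp Require Import zify.
From Stdlib Require Import Classical.

(* Discharging on an edge-minimal counterexample.  Let k be the maximum degree
   and let R be the (k+2)-core of the graph "at distance at most 2".  Vertices
   outside R can be coloured greedily after all others, so by minimality they
   form an independent set, and every v in R has at least k+2 vertices of R
   within distance 2; the latter number is at most the sum of the contributions
   t(w) of the neighbours w of v.  Give v the charge deg v - 3.  A vertex of
   large degree gives 4/5 to each neighbour; the bound on contributions forces
   every needy vertex to have such a vertex nearby, so that local rules leave a
   deficit only at the special vertices.  A special vertex has degree at most
   3, exactly k+2 vertices of R within distance 2, and a neighbour (its hub) of
   degree k all of whose neighbours are in R.  Each hub has 2/5 left over.

   Special vertices may be uncoloured together, and then each keeps at least as
   many colours as it has uncoloured vertices within distance 2.  Hence, by the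
   Erdos-Rubin-Taylor argument, an even cycle of special vertices (for adjacency
   at distance at most 2) cannot contain three consecutive vertices whose first
   and last are nonadjacent.  So the links between special vertices of different
   hubs form, up to odd cycles and copies of K4, a forest on the hubs, and the
   total deficit is at most the amount left over at the hubs. *)

Set Implicit Arguments.
Unset Strict Implicit.
Unset Printing Implicit Defensive.

(** * Colouring along paths and cycles *)

Section ListColoring.

Variables (V : finType) (C : eqType) (Q : rel V) (L : V -> seq C).
Hypotheses (Qsym : symmetric Q) (Qirr : irreflexive Q).

Definition proper_on (W : {set V}) (f : V -> C) : Prop :=
  (forall x, x \in W -> f x \in L x) /\
  (forall x y, x \in W -> y \in W -> Q x y -> f x != f y).

Lemma proper_onS (W W' : {set V}) f :
  W' \subset W -> proper_on W f -> proper_on W' f.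
Proof.
move=> /subsetP sW [fL fQ]; split=> [x /sW /fL //|x y /sW Wx /sW Wy].
exact: fQ.
Qed.

(** [s] has to list only the neighbouring colours that lie in [L v]. A neighbour coloured outside
    [L v], or two neighbours of equal colour, thus save a colour. *)
Lemma extend_proper (W : {set V}) (f : V -> C) v (s : seq C) :
  proper_on W f -> v \notin W ->
  (forall w, w \in W -> Q v w -> f w \in L v -> f w \in s) ->
  size s < size (L v) -> uniq (L v) ->
  exists f', [/\ proper_on (v |: W) f' & {in W, f' =1 f}].
Proof.
move=> [fL fQ] vW sP ltsL uL.
have [al alL als] : exists2 al, al \in L v & al \notin s.
  apply/hasP; rewrite -[has _ _]negbK -all_predC; apply/negP => /allP /= alls.
  have: size (L v) <= size s.
    by apply: uniq_leq_size => // x /alls /=; rewrite negbK.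
  by rewrite leqNgt ltsL.
exists (fun x => if x == v then al else f x).
have fE x : x \in W -> (if x == v then al else f x) = f x.
  by case: eqP => // ->; rewrite (negPf vW).
have alN w : w \in W -> Q v w -> al != f w.
  move=> Ww vw; apply: contraNneq als => alE; rewrite alE.
  by apply: (sP w) => //; rewrite -alE.
split; last by move=> x /fE.
split=> [x|x y].
  by rewrite in_setU1; case: (eqVneq x v) => [-> //|_] /= /fL.
rewrite !in_setU1.
case: (eqVneq x v) => [->|xv] /=; case: (eqVneq y v) => [->|yv] //=.
- by rewrite Qirr.
- by move=> _; apply: alN.
- by move=> Wx _; rewrite Qsym eq_sym; apply: alN.
- exact: fQ.
Qed.

Lemma extend_proper_lt (W : {set V}) (f : V -> C) v :
  proper_on W f -> v \notin W ->
  #|[set w in W | Q v w]| < size (L v) -> uniq (L v) ->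
  exists f', [/\ proper_on (v |: W) f' & {in W, f' =1 f}].
Proof.
move=> fW vW lt uL.
apply: (extend_proper (s := [seq f w | w <- enum [set w in W | Q v w]])) => //.
  by move=> w Ww vw _; apply: map_f; rewrite mem_enum inE Ww.
by rewrite size_map -cardE.
Qed.

(* Each vertex of the path but the last one is coloured before its successor,
   hence has at most one colour less to avoid than its degree in [U]. *)
Lemma extend_along_path (U D : {set V}) (f : V -> C) v0 (o : seq V) :
  {in U, forall v, uniq (L v) /\ #|[set w in U | Q v w]| <= size (L v)} ->
  proper_on D f -> D \subset U -> {subset v0 :: o <= U} ->
  path Q v0 o -> uniq (v0 :: o) -> {in v0 :: o, forall x, x \notin D} ->
  exists f', proper_on (D :|: [set x in belast v0 o]) f' /\ {in D, f' =1 f}.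
Proof.
move=> LU; elim: o v0 D f => [|v1 o IH] v0 D f fD DU oU /=.
  by move=> *; exists f; split=> //; apply: proper_onS fD; apply/subsetP=> x;
     rewrite !inE orbF.
move=> /andP [v01 po] /andP [v0o uo] oD.
have v0U : v0 \in U by apply: oU; rewrite inE eqxx.
have v1U : v1 \in U by apply: oU; rewrite !inE eqxx orbT.
have v0D : v0 \notin D by apply: oD; rewrite inE eqxx.
have v1D : v1 \notin D by apply: oD; rewrite !inE eqxx orbT.
have [uL0 degL0] := LU _ v0U.
have [|f1 [f1D f1E]] := extend_proper_lt fD v0D _ uL0.
  apply: leq_trans degL0; apply: proper_card; apply/properP; split.
    apply/subsetP=> w; rewrite !inE => /andP [wD ->].
    by rewrite (subsetP DU).
  by exists v1; rewrite !inE ?v1U ?v01 // (negPf v1D).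
have [|x xo|x xo|f' [f'D f'E]] := IH v1 _ f1 f1D _ _ po uo.
- by apply/subsetP=> x; rewrite !inE => /orP [/eqP -> //|]; apply/subsetP.
- by apply: oU; rewrite inE xo orbT.
- rewrite !inE negb_or (oD x) ?andbT; last by rewrite inE xo orbT.
  by apply: contraNneq v0o => <-.
exists f'; split.
  apply: proper_onS f'D; apply/subsetP=> x; rewrite !inE.
  by case/or3P=> ->; rewrite ?orbT.
by move=> x xD; rewrite f'E ?f1E // !inE xD orbT.
Qed.


(** The last vertex [z] stays uncoloured; it is the uncoloured successor that the last entry of [s]
    requires. *)
Lemma extend_along_sorted (U D : {set V}) (f : V -> C) (s : seq V) z :
  {in U, forall v, uniq (L v) /\ #|[set w in U | Q v w]| <= size (L v)} ->
  proper_on D f -> D \subset U -> {subset rcons s z <= U} ->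
  sorted Q (rcons s z) -> uniq (rcons s z) ->
  {in rcons s z, forall x, x \notin D} ->
  exists f', proper_on (D :|: [set x in s]) f' /\ {in D, f' =1 f}.
Proof.
case E: (rcons s z) => [|v0 o]; first by case: s E.
have [-> _] : s = belast v0 o /\ z = last v0 o.
  by have [] := rcons_inj (etrans E (lastI v0 o)).
exact: extend_along_path.
Qed.

(** * Graphs with a Hamiltonian cycle and lists at least as long as the degrees *)

Section CycleColoring.

Variable U : {set V}.
Hypothesis LU :
  {in U, forall v, uniq (L v) /\ #|[set w in U | Q v w]| <= size (L v)}.

(** Colour round the cycle from the successor of [v]: every other vertex precedes its successor, and
    the surplus colour serves [v], which comes last. [c0] seeds the colouring of the empty set, as
    [C] might be empty. *)
Lemma color_cycle_surplus (c0 : V -> C) v q :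
  cycle Q (v :: q) -> uniq (v :: q) -> v :: q =i U ->
  #|[set w in U | Q v w]| < size (L v) -> exists f, proper_on U f.
Proof.
move=> cq uq memq surp.
have p0 : proper_on set0 c0 by split=> x; rewrite inE.
have vU : v \in U by rewrite -memq inE eqxx.
have [uLv _] := LU vU.
case: q => [|v0 q] in cq uq memq *; first by rewrite /= Qirr in cq.
move: cq uq => /=; rewrite rcons_path => /and3P [vv0 pathq lastv] /andP [vq uq'].
have pathqv : path Q v0 (rcons q v) by rewrite rcons_path pathq.
have uqv : uniq (v0 :: rcons q v) by rewrite -rcons_cons rcons_uniq vq.
have [x xq|x _|f [fP _]] := extend_along_path LU p0 (sub0set _) _ pathqv uqv.
- by rewrite -memq -mem_rcons.
- by rewrite inE.
rewrite belast_rcons set0U in fP.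
have [||f' [f'P _]] := extend_proper_lt fP _ _ uLv.
- by rewrite inE.
- apply: leq_ltn_trans surp; apply: subset_leq_card; apply/subsetP=> w.
  by rewrite !inE -memq => /andP [wq ->]; rewrite !inE wq orbT.
exists f'; apply: proper_onS f'P; apply/subsetP=> x.
by rewrite -memq !inE.
Qed.

(** Give [v] the colour [al] and go round to [last v q], coloured last: its neighbour [v] blocks
    none of its colours. *)
Lemma color_cycle_asym (c0 : V -> C) v q al :
  cycle Q (v :: q) -> uniq (v :: q) -> v :: q =i U ->
  al \in L v -> al \notin L (last v q) -> exists f, proper_on U f.
Proof.
move=> cq uq memq alv all.
have p0 : proper_on [set v] (fun _ => al).
  split=> [x|x y]; rewrite !inE => /eqP -> // /eqP ->.
  by rewrite Qirr.
have vU : v \in U by rewrite -memq inE eqxx.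
case/lastP: q => [|q z] in cq uq memq all *; first by rewrite /= Qirr in cq.
rewrite last_rcons in all.
have zU : z \in U by rewrite -memq inE mem_rcons inE eqxx orbT.
have zv : Q z v.
  by move: cq; rewrite /= rcons_path last_rcons => /andP [].
have [uLz degz] := LU zU.
have [f [fP fE]] : exists f,
    proper_on (v |: [set x in q]) f /\ {in [set v], f =1 (fun _ => al)}.
  case: q => [|v0 q] in cq uq memq *.
    exists (fun=> al); split=> //; apply: proper_onS p0.
    by apply/subsetP=> x; rewrite !inE orbF.
  have /= /andP [vq uq'] := uq.
  have pathq : path Q v0 (rcons q z).
    by move: cq => /= /andP [_]; rewrite rcons_path => /andP [].
  have [|x xq|x xq|f [fP fE]] := extend_along_path LU p0 _ _ pathq uq'.
  - by rewrite sub1set.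
  - by rewrite -memq rcons_cons in_cons xq orbT.
  - by rewrite in_set1; apply: contraNneq vq => <-.
  by exists f; rewrite belast_rcons in fP.
have zD : z \notin v |: [set x in q].
  move: uq; rewrite /= mem_rcons rcons_uniq !inE !negb_or => /and3P [/andP [vz _] zq _].
  by rewrite eq_sym vz.
set s := [seq f w | w <- enum [set w in q | Q z w]].
have [w wD zw fw||f' [f'P _]] := extend_proper (s := s) fP zD _ _ uLz.
- apply: map_f; rewrite mem_enum inE zw andbT; move: wD; rewrite !inE.
  case/orP=> // /eqP wv; rewrite wv fE ?inE // in fw.
  by rewrite fw in all.
- rewrite size_map -cardE; apply: leq_trans degz; apply: proper_card.
  apply/properP; split.
    apply/subsetP=> w; rewrite !inE -memq => /andP [wq ->].
    by rewrite inE mem_rcons inE wq !orbT.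
  exists v; rewrite !inE ?vU ?zv //.
  by move: uq; rewrite /= mem_rcons inE negb_or -andbA => /and3P [_ /negPf ->].
exists f'; apply: proper_onS f'P; apply/subsetP=> x.
by rewrite -memq !inE mem_rcons inE; case/or3P=> ->; rewrite ?orbT.
Qed.

Lemma prev_head (v : V) q : v \notin q -> prev (v :: q) v = last v q.
Proof.
suff H y : v \notin q -> prev_at v v y q = last y q by apply: H.
elim: q y => [|w q IH] y /=; first by rewrite eqxx.
by rewrite inE negb_or => /andP [/negPf -> /IH].
Qed.

(** By [color_cycle_asym] each list is contained in that of the preceding vertex; going once round
    the cycle makes all lists equal. *)
Lemma color_cycle_lists_eq p : (V -> C) ->
  cycle Q p -> uniq p -> p =i U -> ~ (exists f, proper_on U f) ->
  {in U &, forall v w, L v =i L w}.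
Proof.
move=> c0 cp up memp noc.
pose r v w := all (mem (L v)) (L w).
have rp : cycle r p.
  apply: cycle_from_prev => // v vp.
  have [i q Eq] := rot_to vp.
  have cq : cycle Q (v :: q) by rewrite -Eq rot_cycle.
  have uq : uniq (v :: q) by rewrite -Eq rot_uniq.
  have memq : v :: q =i U by move=> x; rewrite -memp -Eq mem_rot.
  rewrite -(prev_rot i up) Eq prev_head; last by case/andP: uq.
  apply/allP=> al alv; apply: contraT => alN; case: noc.
  exact: (color_cycle_asym c0 cq uq memq alv).
have rtrans : transitive r.
  move=> y x z /allP xy /allP yz; apply/allP=> al /yz; exact: xy.
have := cycle_all2rel rtrans p; rewrite rp => /esym /allrelP rall.
move=> v w; rewrite -!memp => vp wp al; apply/idP/idP.
  by apply: (allP (rall _ _ wp vp)).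
by apply: (allP (rall _ _ vp wp)).
Qed.

Lemma color_even_cycle_deg2 p : (V -> C) ->
  cycle Q p -> uniq p -> p =i U -> ~~ odd (size p) -> 2 < size p ->
  {in U &, forall v w, L v =i L w} ->
  {in U, forall v, #|[set w in U | Q v w]| = 2 /\ size (L v) = 2} ->
  exists f, proper_on U f.
Proof.
move=> c0 cp up memp evp sp LE deg2.
case: p => [|v0 p] // in cp up memp evp sp *.
have v0U : v0 \in U by rewrite -memp inE eqxx.
have [_ sz] := deg2 _ v0U; have [uL _] := LU v0U.
case EL : (L v0) sz uL => [|al [|be []]] //= _; rewrite inE andbT => albe.
pose f v := if odd (index v (v0 :: p)) then al else be.
have fN v w : v \in U -> w \in U -> Q v w -> w = next (v0 :: p) v -> f v != f w.
  move=> vU wU vw ->; rewrite next_nth memp vU /f.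
  move: vU; rewrite -memp => vp.
  have ltv : index v (v0 :: p) < (size p).+1 by rewrite -[(size p).+1]/(size (v0 :: p)) index_mem.
  set i := index v _ in ltv *.
  have [ltv'|gev] := ltnP i (size p).
    have -> : nth v0 p i = nth v0 (v0 :: p) i.+1 by [].
    rewrite index_uniq // oddS.
    by case: (odd i); rewrite //= eq_sym.
  (* The last vertex: its successor is [v0], supplied as the default of [nth], and its index is odd
     because the cycle is even. *)
  rewrite nth_default // /= eqxx /=.
  have -> : i = size p by lia.
  by move: evp => /=; rewrite negbK => ->.
exists f; split=> [x xU|x y xU yU xy].
  by rewrite (LE _ _ xU v0U) EL /f !inE; case: ifP; rewrite eqxx ?orbT.
have [dx _] := deg2 _ xU.
have xp : x \in v0 :: p by rewrite memp.
have nU : next (v0 :: p) x \in U by rewrite -memp mem_next.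
have pU : prev (v0 :: p) x \in U by rewrite -memp mem_prev.
have xn : Q x (next (v0 :: p) x) := next_cycle cp xp.
have xpr : Q x (prev (v0 :: p) x) by rewrite Qsym (prev_cycle cp xp).
have np : next (v0 :: p) x != prev (v0 :: p) x.
  apply/eqP=> E.
  have [i q Eq] := rot_to xp.
  have uq : uniq (x :: q) by rewrite -Eq rot_uniq.
  move: E; rewrite -(next_rot i up) -(prev_rot i up) Eq prev_head; last by case/andP: uq.
  have {sp} : 1 < size q by move: sp; rewrite -(size_rot i) Eq.
  case: q uq {Eq} => [|y0 [|y1 q]] //=.
  rewrite eqxx inE => /and4P [_ /norP [y01 yq] _ _] _ E.
  move: (mem_last y1 q); rewrite -E inE (negPf y01) /=; exact/negP.
have : y \in [set next (v0 :: p) x; prev (v0 :: p) x].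
  suff <- : [set w in U | Q x w] = [set next (v0 :: p) x; prev (v0 :: p) x].
    by rewrite inE yU.
  apply/esym/eqP; rewrite eqEcard dx cards2 np andbT.
  by apply/subsetP=> w; rewrite !inE => /orP [/eqP ->|/eqP ->]; rewrite ?nU ?pU.
rewrite !inE => /orP [/eqP yE|/eqP yE]; first exact: fN.
by rewrite eq_sym; apply: fN => //; rewrite 1?Qsym // yE next_prev.
Qed.

(* The degree-choosability argument of Erdos, Rubin and Taylor for a graph with
   a Hamiltonian cycle: unequal lists or a surplus let the cycle be coloured
   greedily, otherwise the two neighbours [a] and [b] of [x] share a colour. *)
Lemma color_even_cycle (c0 : V -> C) a x b q :
  cycle Q [:: a, x, b & q] -> uniq [:: a, x, b & q] ->
  [:: a, x, b & q] =i U -> odd (size q) -> ~~ Q a b ->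
  ~ ~ exists f, proper_on U f.
Proof.
set p := [:: a, x, b & q] => cp up memp oq nab noc.
have degE v : v \in U -> #|[set w in U | Q v w]| = size (L v).
  move=> vU; have [_ dv] := LU vU; apply/eqP; rewrite eqn_leq dv leqNgt.
  apply/negP=> lt; apply: noc.
  have vp : v \in p by rewrite memp.
  have [i r Eq] := rot_to vp.
  apply: (color_cycle_surplus (v := v) (q := r) c0) => //.
  - by rewrite -Eq rot_cycle.
  - by rewrite -Eq rot_uniq.
  - by move=> z; rewrite -memp -Eq mem_rot.
have LE := color_cycle_lists_eq c0 cp up memp noc.
have szE : {in U &, forall v w, size (L v) = size (L w)}.
  move=> v w vU wU; have [uv _] := LU vU; have [uw _] := LU wU.
  by apply: perm_size; apply: uniq_perm => //; apply: LE.
have [aU xU bU] : [/\ a \in U, x \in U & b \in U].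
  by rewrite -!memp !inE !eqxx ?orbT.
have [xa xb] : Q x a /\ Q x b.
  by move: cp => /= /and3P [ax xb _]; rewrite Qsym.
have ab : a != b by apply: contraTneq up => E; rewrite /p E /= !inE eqxx orbT.
(* Either [x] has a third neighbour [z] in [U], or its degree is 2; in the latter case equal lists
   make all degrees 2, and two alternating colours suffice. *)
have [z /and3P [zU xz /andP [za zb]]|deg2] :=
  pickP (fun z => [&& z \in U, Q x z, z != a & z != b]); last first.
  apply: noc; apply: (color_even_cycle_deg2 c0 cp up memp) => //.
  - by rewrite /= negbK oq.
  - have dx : #|[set w in U | Q x w]| = 2.
      transitivity #|[set a; b]|; last by rewrite cards2 ab.
      apply: eq_card => w; have := deg2 w; rewrite !inE.
      case: (eqVneq w a) => [->|_]; first by rewrite aU xa.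
      case: (eqVneq w b) => [->|_]; first by rewrite bU xb.
      by rewrite !andbT.
    by move=> v vU; rewrite degE // -dx degE //; split; apply: szE.
have zq : z \in q.
  move: zU; rewrite -memp !inE (negPf za) (negPf zb) /=.
  by case: (eqVneq z x) xz => [->|//]; rewrite Qirr.
have [al ala] : exists al, al \in L a.
  have : 0 < size (L a) by rewrite -degE // card_gt0; apply/set0Pn; exists x;
    rewrite inE xU Qsym.
  by case: (L a) => [|al s] // _; exists al; rewrite inE eqxx.
have p0 : proper_on [set a; b] (fun=> al).
  split=> [w|v w].
    by rewrite !inE => /orP [] /eqP -> //; rewrite -(LE a b).
  rewrite !inE => /orP [] /eqP -> /orP [] /eqP ->;
    by rewrite ?Qirr ?(negPf nab) // Qsym (negPf nab).
have {}memp y : (y \in U) = (y \in p) by rewrite memp.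
case/splitPr: zq @p memp cp up {oq} => q1 q2 p memp cp up.
have q1U : {subset q1 <= U}.
  by move=> y yq; rewrite memp !inE mem_cat yq !orbT.
have q2U : {subset q2 <= U}.
  by move=> y yq; rewrite memp !inE mem_cat inE yq !orbT.
have [sq1 sq2] : sorted Q (rcons q1 z) /\ sorted Q (z :: q2).
  move: cp => /= /and3P [_ _]; rewrite rcons_cat cat_path /= => /and3P [p1 l1].
  rewrite rcons_path => /andP [p2 _]; split=> //.
  by apply: (@path_sorted _ Q b); rewrite rcons_path p1.
have [ux [q1N q2N] zN uq] : [/\ x \notin [set a; b],
    {in q1, forall y, y \notin [set a; b]} /\
    {in q2, forall y, [&& y \notin [set a; b], y \notin q1 & y != x]},
    z \notin q1 & [/\ uniq (rcons q1 z), uniq (z :: q2) & x \notin q1]].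
  move: up; rewrite (cat_uniq [:: a; x; b]) cat_uniq => /and3P [u3 hN].
  move=> /and3P [uq1 /hasPn hN' uq2].
  have N3 y : y \in q1 ++ z :: q2 -> y \notin [:: a; x; b] by apply/hasPn.
  have ux : x \notin [set a; b].
    by move: u3; rewrite /= !inE negb_or -andbA eq_sym => /and3P [/negPf -> _ /andP [/negPf ->]].
  split=> //.
  - split=> y yq.
      have := N3 y; rewrite mem_cat yq !inE => /(_ isT).
      by case/norP=> /negPf -> /norP [_ /negPf ->].
    have yq' : y \in z :: q2 by rewrite inE yq orbT.
    have := N3 y; rewrite mem_cat yq' orbT !inE => /(_ isT).
    by case/norP=> /negPf -> /norP [-> /negPf ->]; rewrite andbT; apply: hN'.
  - by apply: hN'; rewrite inE eqxx.
  - split=> //; first by rewrite rcons_uniq uq1 andbT hN' // inE eqxx.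
    apply/negP=> xq; have := N3 x; rewrite mem_cat xq => /(_ isT).
    by rewrite !inE eqxx orbT.
case: uq => uq1 uq2 xq1.
have zab : z \notin [set a; b] by rewrite !inE negb_or za.
(* Colour [q1] towards [z], then the reverse of [q2] followed by [z] towards [x]: each vertex still
   has an uncoloured successor, and [x] is left for the end. *)
have [||y|f1 [f1P f1E]] := extend_along_sorted LU p0 _ _ sq1 uq1.
- by apply/subsetP=> y; rewrite !inE => /orP [] /eqP ->.
- by move=> y; rewrite mem_rcons inE => /orP [/eqP -> //|/q1U].
- by rewrite mem_rcons inE => /orP [/eqP -> //|/q1N].
have sq2' : sorted Q (rcons (rcons (rev q2) z) x).
  rewrite -rev_cons; have : sorted Q (rev (x :: z :: q2)).
    rewrite rev_sorted; have /eq_sorted -> : (fun y w => Q w y) =2 Q by [].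
    by rewrite /= xz.
  by rewrite rev_cons.
have uq2' : uniq (rcons (rcons (rev q2) z) x).
  rewrite -!rev_cons rev_uniq /= -[(_ \notin q2) && _]/(uniq (z :: q2)) uq2 andbT.
  rewrite inE negb_or; apply/andP; split.
    by apply: contraTneq xz => ->; rewrite Qirr.
  by apply/negP=> /q2N /and3P []; rewrite eqxx.
have [||y|f2 [f2P f2E]] := extend_along_sorted LU f1P _ _ sq2' uq2'.
- apply/subsetP=> y; rewrite !inE -orbA => /or3P [/eqP ->|/eqP ->|/q1U] //.
- move=> y; rewrite mem_rcons in_cons mem_rcons in_cons mem_rev => /or3P [/eqP ->|/eqP ->|/q2U] //.
- rewrite mem_rcons in_cons mem_rcons in_cons mem_rev.
  case/or3P=> [/eqP ->|/eqP ->|/q2N /and3P [yab yq _]].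
  + by rewrite in_setU in_set negb_or ux.
  + by rewrite in_setU in_set negb_or zab.
  + by rewrite in_setU in_set negb_or yab.
set D := _ :|: _ in f2P.
have [aD bD] : a \in D /\ b \in D by rewrite !inE !eqxx ?orbT.
have f2ab : f2 b = f2 a.
  have [aD' bD'] : a \in [set a; b] /\ b \in [set a; b] by rewrite !inE !eqxx ?orbT.
  have aD1 : a \in [set a; b] :|: [set x0 in q1] by rewrite inE aD'.
  have bD1 : b \in [set a; b] :|: [set x0 in q1] by rewrite inE bD'.
  by rewrite !f2E // !f1E.
have xD : x \notin D.
  rewrite /D 2!in_setU 2!in_set !negb_or ux xq1 /=.
  by move: uq2'; rewrite rcons_uniq => /andP [].
have [uLx _] := LU xU.
have DU y : y \in U -> y != x -> y \in D.
  rewrite memp /D !inE mem_cat mem_rcons !inE mem_rev => h yx.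
  move: h; rewrite (negPf yx) /=.
  by do ![case/orP=> [->|]; rewrite ?orbT //]; move=> ->; rewrite ?orbT.
set s := [seq f2 w | w <- enum [set w in U | Q x w & w != b]].
have [w wD xw _||f [fP _]] := extend_proper (s := s) f2P xD _ _ uLx.
- have wU : w \in U.
    move: wD; rewrite !inE mem_rcons in_cons mem_rev -!orbA.
    by case/or4P=> [/eqP ->|/eqP ->|/q1U|/orP [/eqP ->|/q2U]].
  have [->|wb] := eqVneq w b; last by apply: map_f; rewrite mem_enum inE wU xw.
  by rewrite f2ab; apply: map_f; rewrite mem_enum inE aU xa.
- rewrite size_map -cardE -degE //; apply: proper_card; apply/properP; split.
    by apply/subsetP=> w; rewrite !inE => /and3P [-> ->].
  by exists b; rewrite !inE ?bU ?xb // eqxx !andbF.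
apply: noc; exists f; apply: proper_onS fP; apply/subsetP=> y yU.
by rewrite in_setU1; case: eqVneq => //= yx; apply: DU.
Qed.
End CycleColoring.
End ListColoring.

Lemma uniq_size_card (T : finType) (s : seq T) : uniq s -> size s <= #|T|.
Proof. by move=> /card_uniqP <-; apply: max_card. Qed.

Lemma split_mem (T : eqType) (x : T) (s : seq T) :
  x \in s -> exists s1 s2, s = s1 ++ x :: s2.
Proof. by case/splitPr=> s1 s2; exists s1, s2. Qed.

(** * Alternating cycles and link graphs of maximum degree 2 *)

Section AlternatingCycles.

Variables (V A B : finType) (b : V -> B) (kap : V -> A).

(* [b] and [kap] make [S] the edge set of a bipartite graph; a list of pairs
   sharing their [kap] end and chained by their [b] ends is a cycle of it. *)
Definition kap_pair (S : {set V}) (p : V * V) : bool :=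
  [&& p.1 \in S, p.2 \in S, p.1 != p.2 & kap p.1 == kap p.2].

Definition alternating_cycle (S : {set V}) (l : seq (V * V)) : Prop :=
  [/\ l != [::], all (kap_pair S) l, uniq [seq kap p.1 | p <- l] &
      cycle (fun p q => b p.2 == b q.1) l].

(** All degrees in the bipartite graph are at least 2, so a path of pairs can grow at its front
    until a [kap] end repeats, which closes a cycle. *)
Lemma alternating_cycle_exists (S : {set V}) :
  S != set0 ->
  (forall s, s \in S -> exists t, [/\ t \in S, t != s & b t = b s]) ->
  (forall s, s \in S -> exists t, [/\ t \in S, t != s & kap t = kap s]) ->
  exists l, alternating_cycle S l.
Proof.
move=> /set0Pn [s0 s0S] bS kS.
pose r (p q : V * V) := b p.2 == b q.1.
have H n : (exists l, alternating_cycle S l) \/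
   exists p l, [/\ size l = n, all (kap_pair S) (p :: l),
      uniq [seq kap q.1 | q <- p :: l] & path r p l].
  elim: n => [|n [|[p [l [szl al ul pl]]]]]; last 2 first.
  - by left.
  - have /andP [/and4P [p1S p2S p12 kp12] all_l] := al.
    have [z [zS zp bz]] := bS _ p1S.
    have [w [wS wz kw]] := kS _ zS.
    have [kzl|kzl] := boolP (kap z \in [seq kap q.1 | q <- p :: l]); last first.
      right; exists (w, z), (p :: l); split; rewrite /= ?szl //.
      + by rewrite /kap_pair /= wS zS wz kw eqxx; move: al => /= ->.
      + by rewrite kw; move: kzl ul => /= -> ->.
      + by rewrite /r /= bz eqxx.
    left; have [q ql kzq] := mapP kzl.
    have [l1 [l2 El]] := split_mem ql.
    have /and4P [q1S q2S q12 kq12] : kap_pair S q by apply: (allP al).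
    (* If [kap z] repeats the end of [p] itself, then [p.1] and [z] are parallel edges and form a
       cycle of one pair. *)
    case: l1 El => [|p' l1] /= [].
      move=> Epq _; exists [:: (p.1, z)]; split=> //=.
        by rewrite /kap_pair /= p1S zS eq_sym zp kzq Epq eqxx.
      by rewrite bz eqxx.
    move=> _ El; move: ul al pl; rewrite El -cat_cons map_cat cat_uniq.
    case/and3P=> /= /andP [pk ul1] /norP [kq _] _.
    rewrite all_cat cat_path => /and3P [pS l1S _] /and3P [pl1 rq _].
    (* If [z] is [q.1], the cycle closes just before [q]; otherwise [q] is replaced by
       [(q.1, z)]. *)
    have [zq|zq] := eqVneq z q.1.
      exists (p :: l1); split=> //=; rewrite ?pS ?pk //.
      by rewrite rcons_path pl1 /= -bz zq.
    exists (p :: rcons l1 (q.1, z)); split=> //=.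
    + rewrite all_rcons l1S andbT pS /= /kap_pair /= q1S zS eq_sym zq.
      by rewrite kzq eqxx.
    + rewrite map_rcons mem_rcons rcons_uniq /= inE negb_or pk ul1 andbT.
      by move: kq; rewrite inE negb_or eq_sym => /andP [-> ->].
    + by rewrite !rcons_path last_rcons /= bz eqxx andbT pl1.
  right; have [t [tS ts kt]] := kS _ s0S.
  exists (t, s0), [::]; split=> //=.
  by rewrite /kap_pair /= tS s0S ts kt eqxx.
have [//|[p [l [szl _ ul _]]]] := H #|A|.
by have := uniq_size_card ul; rewrite size_map /= szl ltnn.
Qed.

(** A forest has no more edges than vertices: some edge has an end of degree 1, and deleting it
    loses a vertex too. *)
Lemma card_le_of_no_alternating_cycle (S : {set V}) :
  (forall l, ~ alternating_cycle S l) -> #|S| <= #|b @: S| + #|kap @: S|.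
Proof.
have [n] := ubnP #|S|; elim: n S => // n IH S; rewrite ltnS => leS noalt.
have drop (C : finType) (f : V -> C) s : s \in S ->
    (forall t, t \in S -> t != s -> f t != f s) -> #|f @: (S :\ s)| < #|f @: S|.
  move=> sS fs; apply: proper_card; apply/properP; split.
    by apply: imsetS; apply: subsetDl.
  exists (f s); first exact: imset_f.
  by apply/imsetP=> [[t]]; rewrite !inE => /andP [ts tS] /esym/eqP;
    apply/negP; apply: fs.
have step s : s \in S -> #|b @: (S :\ s)| + #|kap @: (S :\ s)| < #|b @: S| + #|kap @: S| ->
    #|S| <= #|b @: S| + #|kap @: S|.
  move=> sS lt; rewrite (cardsD1 s) sS; apply: leq_trans lt.
  rewrite add1n ltnS; apply: IH.
    by move: leS; rewrite (cardsD1 s) sS.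
  move=> l [l0 al ul cl]; apply: (noalt l); split=> //.
  apply: sub_all al => p; rewrite /kap_pair !inE.
  by case/and4P=> /andP [_ ->] /andP [_ ->] -> ->.
have mono (C : finType) (f : V -> C) s : #|f @: (S :\ s)| <= #|f @: S|.
  by apply: subset_leq_card; apply: imsetS; apply: subsetDl.
have [->|S0] := eqVneq S set0; first by rewrite cards0.
have choice (C : finType) (f : V -> C) :
    (exists2 s, s \in S & forall t, t \in S -> t != s -> f t != f s) \/
    (forall s, s \in S -> exists t, [/\ t \in S, t != s & f t = f s]).
  have [/existsP [s /andP [sS /forall_inP H]]|] := boolP
    [exists s, (s \in S) && [forall t in S, (t != s) ==> (f t != f s)]].
    by left; exists s => // t /H /implyP.
  rewrite negb_exists => /forallP H; right=> s sS.
  have := H s; rewrite sS /= => /forall_inPn [t tS].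
  by rewrite negb_imply negbK => /andP [ts /eqP]; exists t.
case: (choice _ b) => [[s sS /(drop _ b _ sS) H]|bS].
  by apply: (step s) => //; rewrite -addSn leq_add.
case: (choice _ kap) => [[s sS /(drop _ kap _ sS) H]|kS].
  by apply: (step s) => //; rewrite -addnS leq_add.
by have [l] := alternating_cycle_exists S0 bS kS; move/noalt.
Qed.

End AlternatingCycles.

(** * Cycles of links and their arcs *)

Section Links.

Variables (V : finType) (link : rel V).
Hypotheses (lsym : symmetric link) (lirr : irreflexive link).

Lemma min_degree2_cycle (W : {set V}) :
  W != set0 ->
  {in W, forall x y, exists2 z, z \in W & link x z && (z != y)} ->
  exists p, [/\ cycle link p, uniq p, {subset p <= W} & 2 < size p].
Proof.
move=> /set0Pn [x0 x0W] deg2.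
have H n : (exists p, [/\ cycle link p, uniq p, {subset p <= W} & 2 < size p]) \/
   exists x p, [/\ size p = n, path link x p, uniq (x :: p) & {subset x :: p <= W}].
  elim: n => [|n [|[x [p [szp pp up pW]]]]]; last 2 first.
  - by left.
  - have xW : x \in W by apply: pW; rewrite inE eqxx.
    (* [z] avoids the predecessor [head x p] of [x], so that closing the path gives at least three
       vertices. *)
    have [z zW /andP [xz zp]] := deg2 x xW (head x p).
    have [zxp|zxp] := boolP (z \in x :: p); last first.
      right; exists z, (x :: p); split; rewrite /= ?szp 1?lsym ?xz //.
        by rewrite zxp; move: up => /= ->.
      by move=> y; rewrite inE => /orP [/eqP ->|/pW].
    left; move: zxp; rewrite inE; case: eqVneq xz => [->|zx xz /= zp']; first by rewrite lirr.
    have [p1 [p2 Ep]] := split_mem zp'.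
    exists (x :: rcons p1 z); split.
    + have zx' : link z x by rewrite lsym.
      by move: pp; rewrite /= Ep cat_path !rcons_path last_rcons zx' => /and3P [-> /= ->].
    + move: up; rewrite Ep -cat_rcons -cat_cons cat_uniq.
      by case/andP.
    + move=> y yp; apply: pW; move: yp; rewrite Ep -cat_rcons !inE mem_cat.
      by case/orP=> ->; rewrite ?orbT.
    + case: p1 Ep => [|y p1] Ep; last by rewrite /= size_rcons.
      by rewrite Ep /= eqxx in zp.
  by right; exists x0, [::]; split=> // y; rewrite inE => /eqP ->.
have [//|[x [p [szp _ up _]]]] := H #|V|.
by have := uniq_size_card up; rewrite /= szp ltnn.
Qed.

(** The two arcs from [v] to [w] have an odd number of edges together, so one of them has odd length
    [size q]. *)
Lemma odd_cycle_even_arc p v w :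
  cycle link p -> uniq p -> odd (size p) -> v \in p -> w \in p -> v != w ->
  exists q, [/\ path link v q, last v q = w, uniq (v :: q), odd (size q) &
    {subset v :: q <= p}].
Proof.
move=> cp up oddp vp wp vw.
have [i r Er] := rot_to vp.
have memr y : (y \in p) = (y \in v :: r) by rewrite -Er mem_rot.
have cr : cycle link (v :: r) by rewrite -Er rot_cycle.
have ur : uniq (v :: r) by rewrite -Er rot_uniq.
have szr : ~~ odd (size r) by move: oddp; rewrite -(size_rot i) Er.
have {}wp : w \in r by move: wp; rewrite memr inE eq_sym (negPf vw).
have [r1 [r2 E]] := split_mem wp; rewrite {}E {Er wp} in memr cr ur szr.
move: cr => /=; rewrite rcons_cat cat_path rcons_cons /= => /and3P [p1 l1w p2].
have uv : uniq (v :: r1 ++ w :: r2) := ur.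
case o1: (odd (size r1)).
  exists (rev (w :: r2)); split.
  - have := rev_path link w (rcons r2 v); rewrite last_rcons belast_rcons => ->.
    by have /eq_path -> : (fun z => link^~ z) =2 link by move=> x y; exact: lsym.
  - by rewrite rev_cons last_rcons.
  - move: uv => /= /andP []; rewrite mem_cat cat_uniq negb_or.
    by move=> /andP [_ vN] /and3P [_ _ u2]; rewrite mem_rev vN rev_uniq.
  - by move: szr; rewrite size_rev size_cat oddD o1 /= negbK => /negPf ->.
  - by move=> y; rewrite memr !inE mem_cat mem_rev inE => /orP [] ->; rewrite ?orbT.
exists (rcons r1 w); split.
- by rewrite rcons_path p1.
- by rewrite last_rcons.
- by move: uv; rewrite -cat_rcons -cat_cons cat_uniq => /andP [].
- by rewrite size_rcons /= o1.
- move=> y; rewrite memr -cat_rcons -cat_cons mem_cat => yp.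
  by rewrite [y \in v :: _]yp.
Qed.

End Links.

(** * Decomposition of the weighted links into single links and odd cycles *)

Section Connectors.

Variables (V : finType) (wt : V -> V -> nat).
Hypotheses (wtC : forall v w, wt v w = wt w v) (wt0 : forall v, wt v v = 0).

Definition wlink : rel V := fun v w => 0 < wt v w.

Definition total_wt (W : {set V}) := \sum_(v in W) \sum_(w in W) wt v w.

(** Ordered pairs are counted, so a link between [X] and the rest counts from either end; hence the
    second inner sum. *)
Lemma total_wtD (W X : {set V}) : X \subset W ->
  total_wt W = total_wt (W :\: X) +
    \sum_(x in X) (\sum_(w in W) wt x w + \sum_(w in W :\: X) wt x w).
Proof.
move=> XW; rewrite /total_wt big_split /=.
have part (F : V -> nat) : \sum_(v in W) F v = \sum_(v in X) F v + \sum_(v in W :\: X) F v.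
  by rewrite (big_setID X) /= (setIidPr XW).
have E : \sum_(v in W :\: X) \sum_(w in W) wt v w =
    \sum_(x in X) \sum_(w in W :\: X) wt x w +
    \sum_(v in W :\: X) \sum_(w in W :\: X) wt v w.
  under eq_bigr => v _ do rewrite part.
  rewrite big_split /=; congr (_ + _); rewrite exchange_big /=.
  by apply: eq_bigr => v _; apply: eq_bigr => w _.
by rewrite part E addnA addnC.
Qed.

(* The classes of [kap] are single links and odd cycles of links.  Two vertices
   of a class are joined by a path on an even number of vertices: on an odd
   cycle one of the two arcs has the right parity. *)
Definition connectors (W S : {set V}) (kap : V -> V) : Prop :=
  [/\ S \subset W, {in S, forall x, kap x \in S},
     total_wt W + 4 * #|kap @: S| <= 4 * #|S| &
     {in S &, forall v w, v != w -> kap v = kap w ->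
        exists q, [/\ path wlink v q, last v q = w, uniq (v :: q), odd (size q) &
          {in v :: q, forall x, (x \in S) && (kap x == kap v)}]}].

(** [X] becomes a new class labelled [x0]: 4 per vertex of [X] has to pay for the weight lost with
    [X] and 4 for the class. *)
Lemma connectors_glue (W X S : {set V}) kap x0 :
  X \subset W -> x0 \in X -> connectors (W :\: X) S kap ->
  \sum_(x in X) (\sum_(w in W) wt x w + \sum_(w in W :\: X) wt x w) + 4 <= 4 * #|X| ->
  {in X &, forall v w, v != w ->
        exists q, [/\ path wlink v q, last v q = w, uniq (v :: q), odd (size q) &
          {subset v :: q <= X}]} ->
  connectors W (X :|: S) (fun v => if v \in X then x0 else kap v).
Proof.
move=> XW x0X [SW kS le con] leX conX.
have SX x : x \in S -> x \in X = false.
  by move/(subsetP SW); rewrite inE => /andP [/negPf].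
split.
- by rewrite subUset XW; apply: subset_trans SW _; apply: subsetDl.
- by move=> x; rewrite !inE; case: ifP => [_ _|_ /= /kS ->]; rewrite ?x0X ?orbT.
- have XS0 : [disjoint X & S].
    by rewrite disjoint_subset; apply/subsetP=> x xX; rewrite inE; apply/negP=> /SX; rewrite xX.
  have -> : #|X :|: S| = #|X| + #|S|.
    by rewrite cardsU disjoint_setI0 // cards0 subn0.
  set K := _ @: (X :|: S).
  have leK : #|K| <= 1 + #|kap @: S|.
    rewrite -(cards1 x0); apply: leq_trans (leq_card_setU _ _).
    apply: subset_leq_card; apply/subsetP=> y /imsetP [x xXS ->].
    move: xXS; rewrite !inE; case: ifP => [_ _|_ /= xS]; first by rewrite eqxx.
    by rewrite imset_f ?orbT.
  by rewrite (total_wtD XW); move: le leX leK; clear; lia.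
- move=> v w; rewrite !inE; case vX: (v \in X); case wX: (w \in X) => //=.
  + move=> _ _ vw _; have [q [p1 p2 p3 p4 p5]] := conX _ _ vX wX vw.
    exists q; split=> // x xq; have xX := p5 _ xq.
    by rewrite inE xX /=.
  + by move=> _ wS _ E; have := SX _ (kS _ wS); rewrite -E x0X.
  + by move=> vS _ _ E; have := SX _ (kS _ vS); rewrite E x0X.
  + move=> vS wS vw E; have [q [p1 p2 p3 p4 p5]] := con _ _ vS wS vw E.
    exists q; split=> // x xq; have /andP [xS kx] := p5 _ xq.
    by rewrite inE xS orbT (SX _ xS).
Qed.

(** Peel off an isolated vertex, else a vertex with a single partner together with that partner,
    else a cycle, which is odd by hypothesis. *)
Lemma connectors_exist (W : {set V}) :
  {in W, forall v, \sum_(w in W) wt v w <= 2} ->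
  (forall p, cycle wlink p -> uniq p -> {subset p <= W} -> 3 < size p -> odd (size p)) ->
  exists S kap, connectors W S kap.
Proof.
have lsym : symmetric wlink by move=> x y; rewrite /wlink wtC.
have lirr : irreflexive wlink by move=> x; rewrite /wlink wt0.
have [n] := ubnP #|W|; elim: n W => // n IH W; rewrite ltnS => leW row2 noeven.
have IHX (X : {set V}) x : x \in X -> X \subset W -> exists S kap, connectors (W :\: X) S kap.
  move=> xX XW; apply: IH.
  - apply: leq_trans leW; apply: proper_card; apply/properP.
    by split; [apply: subsetDl|exists x; rewrite ?(subsetP XW) // inE xX].
  - move=> v; rewrite inE => /andP [_ vW]; apply: leq_trans (row2 v vW).
    by rewrite [leqRHS](big_setID X) /= leq_addl.
  - move=> p cp up pW; apply: noeven => // y /pW; rewrite inE => /andP [] //.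
have [->|W0] := eqVneq W set0.
  exists set0, id; split; rewrite ?sub0set ?imset0 ?cards0 /total_wt ?big_set0 //.
  by move=> x y; rewrite inE.
have [/exists_inP [v vW /forall_inP v0]|] := boolP [exists v in W, forall w in W, ~~ wlink v w].
  have XW : [set v] \subset W by rewrite sub1set.
  have vX : v \in [set v] by rewrite inE.
  have [S [kap [SW kS le con]]] := IHX _ _ vX XW.
  exists S, kap; split=> //.
    by apply: subset_trans SW _; apply: subsetDl.
  rewrite (total_wtD XW) big_set1 !big1 ?addn0 // => w.
    by rewrite inE => /andP [_ /v0]; rewrite /wlink -eqn0Ngt => /eqP.
  by move=> /v0; rewrite /wlink -eqn0Ngt => /eqP.
rewrite negb_exists_in => /forall_inP has1.
have [/exists_inP [v vW /exists_inP [w wW /andP [vw /forall_inP vonly]]]|] :=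
  boolP [exists v in W, exists w in W, wlink v w && [forall z in W, wlink v z ==> (z == w)]].
  have vNw : v != w by apply: contraTneq vw => ->; rewrite lirr.
  have XW : [set v; w] \subset W by apply/subsetP=> z; rewrite !inE => /orP [] /eqP ->.
  have vX : v \in [set v; w] by rewrite !inE eqxx.
  have [S [kap con]] := IHX _ _ vX XW.
  exists ([set v; w] :|: S), (fun x => if x \in [set v; w] then v else kap x).
  apply: connectors_glue => //.
    rewrite big_setU1 ?inE //= big_set1 cards2 vNw /=.
    have E1 : \sum_(z in W) wt v z = wt v w.
      rewrite (big_setD1 w) //= big1 ?addn0 // => z; rewrite inE => /andP [zw /vonly].
      by rewrite inE in zw; rewrite (negPf zw) implybF /wlink -eqn0Ngt => /eqP.
    have E2 : \sum_(z in W :\: [set v; w]) wt v z = 0.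
      rewrite big1 // => z; rewrite !inE negb_or -andbA => /and3P [_ zw /vonly].
      by rewrite (negPf zw) implybF /wlink -eqn0Ngt => /eqP.
    (* With [E1] and [E2], the weight of [v w] cancels: the weight lost is at most twice that at
       [w], hence at most 4. *)
    have E3 : \sum_(z in W :\: [set v; w]) wt w z + wt v w <= \sum_(z in W) wt w z.
      rewrite [leqRHS](big_setID [set v; w]) /= addnC leq_add2r.
      by rewrite (setIidPr XW) big_setU1 ?inE //= big_set1 wt0 addn0 wtC.
    by rewrite E1 E2; move: (row2 _ wW) E3; clear; lia.
  move=> x y; rewrite !inE => /orP [] /eqP -> /orP [] /eqP ->; rewrite ?eqxx // => _.
    exists [:: w]; split; rewrite //= ?vw ?inE ?vNw //.
    by move=> z; rewrite !inE.
  exists [:: v]; split; rewrite //= 1?lsym ?vw ?inE 1?eq_sym ?vNw //.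
  by move=> z; rewrite !inE orbC.
rewrite negb_exists_in => /forall_inP no1.
(* Now every vertex of [W] has at least two partners in [W]. *)
have [x xW y|p [cp up pW sp]] := min_degree2_cycle lsym lirr W0.
  have := has1 x xW; rewrite negb_forall_in => /exists_inP [w wW]; rewrite negbK => xw.
  have := no1 x xW; rewrite negb_exists_in => /forall_inP /(_ w wW).
  rewrite xw /= negb_forall_in => /exists_inP [z zW]; rewrite negb_imply => /andP [xz zw].
  have [wy|wy] := eqVneq w y; last by exists w => //; rewrite xw.
  by exists z => //; rewrite xz -wy.
have XW : [set x in p] \subset W by apply/subsetP=> x; rewrite inE => /pW.
case: p => [|x0 p] // in cp up pW sp XW *.
have xX : x0 \in [set x in x0 :: p] by rewrite !inE eqxx.
have oddp : odd (size (x0 :: p)).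
  move: sp; rewrite leq_eqVlt => /orP [/eqP <- //|]; exact: noeven.
have [S [kap con]] := IHX _ _ xX XW.
exists ([set x in x0 :: p] :|: S), (fun x => if x \in [set x in x0 :: p] then x0 else kap x).
apply: connectors_glue => //.
  have cX : #|[set x in x0 :: p]| = size (x0 :: p).
    by rewrite cardsE; apply/card_uniqP.
  rewrite cX; apply: (@leq_trans (\sum_(x in [set x in x0 :: p]) 2 + 4)).
    rewrite leq_add2r; apply: leq_sum => x; rewrite inE => xp.
    have xW := pW _ xp.
    rewrite [X in _ + X]big1 ?addn0; first exact: row2.
    move=> w; rewrite inE => /andP [wp wW]; apply/eqP; rewrite -leqn0 leqNgt.
    apply/negP=> xw.
    (* The cycle neighbours [y0] and [y1] use up the weight 2 at [x], so no link [x w] leaves the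
       cycle. *)
    have [i r Er] := rot_to xp.
    have cr : cycle wlink (x :: r) by rewrite -Er rot_cycle.
    have ur : uniq (x :: r) by rewrite -Er rot_uniq.
    have memr y : (y \in x0 :: p) = (y \in x :: r) by rewrite -Er mem_rot.
    have : 1 < size r by move: sp; rewrite -(size_rot i) Er.
    case: r cr ur memr {Er} => [|y0 r] //=; case/lastP: r => [|r y1] //=.
    rewrite !rcons_path last_rcons => /and3P [xy0 _ y1x] /and3P [_ y01 _] memr _.
    have {}y01 : y0 != y1 by apply: contraNneq y01 => ->; rewrite mem_rcons inE eqxx.
    have y0p : y0 \in x0 :: p by rewrite memr !inE eqxx orbT.
    have y1p : y1 \in x0 :: p by rewrite memr !inE mem_rcons inE eqxx !orbT.
    have wy0 : w != y0 by apply: contraNneq wp => ->; rewrite inE.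
    have wy1 : w != y1 by apply: contraNneq wp => ->; rewrite inE.
    have := row2 _ xW; rewrite (big_setD1 y0) ?pW //= (big_setD1 y1) /=; last first.
      by rewrite !inE eq_sym y01 pW.
    rewrite (big_setD1 w) /=; last by rewrite !inE wy0 wy1.
    have a1 : 0 < wt x y1 by rewrite wtC.
    rewrite leqNgt => /negP [].
    exact: (leq_add xy0 (leq_add a1 (leq_trans xw (leq_addr _ _)))).
  by rewrite sum_nat_const cX; move: sp; rewrite /=; clear; lia.
move=> v w; rewrite 2!in_set => vp wp vw.
have [q [q1 q2 q3 q4 q5]] := odd_cycle_even_arc lsym cp up oddp vp wp vw.
by exists q; split=> // z /q5; rewrite in_set.
Qed.

End Connectors.

(** * The links span few special vertices *)

Section Counting.

Variables (V : finType) (wt : V -> V -> nat) (b : V -> V) (near : rel V).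
Variable S0 : {set V}.
Hypotheses (wtC : forall v w, wt v w = wt w v) (wt0 : forall v, wt v v = 0).
Hypothesis row2 : {in S0, forall v, \sum_(w in S0) wt v w <= 2}.
Hypothesis link_b : {in S0 &, forall v w, wlink wt v w -> b v != b w}.
Hypothesis nearE : {in S0 &, forall v w,
  near v w = (v != w) && ((b v == b w) || wlink wt v w)}.
Hypothesis no_even_cycle : forall a x c q,
  cycle near [:: a, x, c & q] -> uniq [:: a, x, c & q] ->
  {subset [:: a, x, c & q] <= S0} -> odd (size q) ->
  (exists v w, [/\ v \in [:: a, x, c & q], w \in [:: a, x, c & q] & wlink wt v w]) ->
  near a c.

Local Notation link := (wlink wt).

Let linkC : symmetric link. Proof. by move=> x y; rewrite /wlink wtC. Qed.
Let linkN v w : link v w -> v != w.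
Proof. by apply: contraTneq => ->; rewrite /wlink wt0. Qed.

Let link_near v w : v \in S0 -> w \in S0 -> link v w -> near v w.
Proof. by move=> vS wS vw; rewrite nearE // linkN // vw orbT. Qed.

Let same_near v w : v \in S0 -> w \in S0 -> b v = b w -> v != w -> near v w.
Proof. by move=> vS wS bvw vw; rewrite nearE // vw bvw eqxx. Qed.

Let near_link v w : v \in S0 -> w \in S0 -> near v w -> b v != b w -> link v w.
Proof. by move=> vS wS; rewrite nearE // => /andP [_ /orP [->|]]. Qed.

Let near_b v w : v \in S0 -> w \in S0 -> near v w -> ~~ link v w -> b v = b w.
Proof. by move=> vS wS; rewrite nearE // => /andP [_ /orP [/eqP|->]]. Qed.

Lemma three_links v x y z : [/\ v \in S0, x \in S0, y \in S0 & z \in S0] ->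
  x != y -> x != z -> y != z -> link v x -> link v y -> ~~ link v z.
Proof.
move=> [vS xS yS zS] xy xz yz vx vy; apply/negP=> vz.
have := row2 vS; rewrite (big_setD1 x) //= (big_setD1 y) /=; last first.
  by rewrite !inE eq_sym xy.
rewrite (big_setD1 z) /=; last by rewrite !inE eq_sym yz eq_sym xz.
rewrite leqNgt => /negP [].
exact: (leq_add vx (leq_add vy (leq_trans vz (leq_addr _ _)))).
Qed.

(* The only even cycles that survive: [near] induces a complete graph on them. *)
Definition linked_K4 v0 v1 v2 v3 : bool :=
  [&& all (mem S0) [:: v0; v1; v2; v3], uniq [:: v0; v1; v2; v3],
      link v0 v1, link v1 v2, link v2 v3, link v3 v0, b v0 == b v2 & b v1 == b v3].

Lemma linked_K4_rot v0 v1 v2 v3 : linked_K4 v0 v1 v2 v3 -> linked_K4 v1 v2 v3 v0.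
Proof.
case/and5P=> a u l01 l12 /and4P [l23 l30 b02 b13].
have u' : uniq [:: v1; v2; v3; v0] by rewrite -[X in uniq X]/(rot 1 [:: v0; v1; v2; v3]) rot_uniq.
rewrite /linked_K4 u' l12 l23 l30 l01 b13 eq_sym b02 /=.
by move: a => /= /and5P [-> -> -> -> _].
Qed.

(** Vertices two apart on the cycle are [near], so they are linked if their [b] values differ: [w]
    to [v1], and [w'] to [v]. On a longer cycle the vertex [z] after [v1] would be a third link of
    [v]. *)
Lemma mixed_even_cycle w' w v v1 q :
  cycle near [:: w', w, v, v1 & q] -> uniq [:: w', w, v, v1 & q] ->
  {subset [:: w', w, v, v1 & q] <= S0} -> ~~ odd (size q) ->
  b w = b v -> link v v1 -> link w' w -> linked_K4 v v1 w w'.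
Proof.
move=> cp up pS evq bwv vv1 w'w.
have [w'S wS vS v1S] : [/\ w' \in S0, w \in S0, v \in S0 & v1 \in S0].
  by split; apply: pS; rewrite !inE eqxx ?orbT.
have rotP i a x c q' : rot i [:: w', w, v, v1 & q] = [:: a, x, c & q'] -> near a c.
  move=> E; apply: (@no_even_cycle a x c q'); rewrite -?E ?rot_cycle ?rot_uniq //.
  - by move=> z; rewrite mem_rot; apply: pS.
  - have := size_rot i [:: w', w, v, v1 & q]; rewrite E /= => -[->].
    by rewrite /= evq.
  - by exists v, v1; rewrite !mem_rot !inE !eqxx !orbT.
have wv1 : link w v1.
  apply: near_link => //; last by rewrite bwv link_b.
  by apply: (rotP 1 w v v1 (rcons q w')); rewrite /= rot1_cons.
have w'v : link w' v.
  by apply: near_link => //; [exact: (rotP 0) | rewrite -bwv link_b].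
have [ww' vw vw' v1w'] : [/\ w != w', v != w, v != w' & v1 != w'].
  move: up; rewrite /= !inE !negb_or => /and3P [/and4P [a1 a2 a3 _] /and3P [a4 a5 _] _].
  by split; rewrite eq_sym.
have [v1v v1w] : link v1 v /\ link v1 w by rewrite linkC vv1 linkC wv1.
case: q => [|z q] in cp up pS evq rotP *.
  have bv1w' : b v1 = b w'.
    apply: near_b => //; first by move: cp => /= /and5P [].
    exact: (three_links (And4 v1S vS wS w'S) vw vw' ww').
  have u' : uniq [:: v; v1; w; w'].
    by rewrite /= !inE !negb_or (linkN vv1) vw vw' (linkN v1w) v1w' ww'.
  rewrite /linked_K4 u' vv1 v1w (linkC w) w'w w'v bv1w' bwv !eqxx /=.
  by rewrite wS w'S vS v1S.
have zS : z \in S0 by apply: pS; rewrite !inE eqxx !orbT.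
have [wz vz w'z v1z] : [/\ w != z, v != z, w' != z & v1 != z].
  move: up; rewrite /= !inE !negb_or.
  case/and5P=> /and5P [_ _ _ -> _] /and4P [_ _ -> _] /and3P [_ -> _] /andP [-> _] _ //.
have n1z : near v1 z by move: cp => /= /and5P [].
have nvz : near v z by apply: (rotP 2 v v1 z (q ++ [:: w'; w])).
have bv1z : b v1 = b z.
  by apply: near_b => //; apply: (three_links (And4 v1S vS wS zS) vw vz wz).
have lvz : link v z by apply: near_link; rewrite // -bv1z link_b.
have w'Nz : z != w' by rewrite eq_sym.
by case/negP: (three_links (And4 vS v1S zS w'S) v1z v1w' w'Nz vv1 lvz); rewrite linkC.
Qed.

(** A further vertex [u] would give the even cycle [u], [v], [v1], [v2], whose chord from [u] to
    [v1] is a third link at [v1]. *)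
Lemma linked_K4_fibre v v1 v2 v3 u : linked_K4 v v1 v2 v3 ->
  u \in S0 -> b u = b v -> (u == v) || (u == v2).
Proof.
case/and5P=> aS uv l01 l12 /and4P [l23 l30 /eqP b02 /eqP b13] uS bu.
apply: contraT; rewrite negb_or => /andP [uNv uNv2].
move: aS => /= /and5P [vS v1S v2S v3S _].
have bv1 : b v != b v1 by apply: link_b.
have uNv1 : u != v1 by apply: contraNneq bv1 => <-; rewrite bu.
have vv2 : v != v2 by move: uv; rewrite /= !inE !negb_or => /andP [/and3P []].
have v1v2 : v1 != v2 := linkN l12.
have v0v1 : v != v1 := linkN l01.
have : near u v1.
  apply: (@no_even_cycle u v v1 [:: v2]) => //.
  - rewrite /= same_near // link_near // link_near // same_near //; last by rewrite eq_sym.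
    by rewrite bu.
  - by rewrite /= !inE !negb_or uNv uNv1 uNv2 v0v1 vv2 v1v2.
  - by move=> x; rewrite !inE => /or4P [] /eqP ->.
  - by exists v, v1; rewrite !inE !eqxx !orbT.
move=> /(near_link uS v1S); rewrite bu bv1 linkC => /(_ isT) l1u.
have [vNu v2Nu] : v != u /\ v2 != u by split; rewrite eq_sym.
by case/negP: (three_links (And4 v1S vS v2S uS) vv2 vNu v2Nu (etrans (linkC _ _) l01) l12).
Qed.

Let Exc : {set V} :=
  [set v in S0 | [exists v1, [exists v2, [exists v3, linked_K4 v v1 v2 v3]]]].

Let ExcP v : reflect (exists v1 v2 v3, linked_K4 v v1 v2 v3) (v \in Exc).
Proof.
rewrite inE; apply: (iffP andP).
  by case=> _ /existsP [v1 /existsP [v2 /existsP [v3 H]]]; exists v1, v2, v3.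
case=> v1 [v2 [v3 H]]; split; first by case/andP: H => /= /andP [].
by apply/existsP; exists v1; apply/existsP; exists v2; apply/existsP; exists v3.
Qed.

Let ExcS : Exc \subset S0. Proof. by apply/subsetP=> x; rewrite inE => /andP []. Qed.

(** No link leaves [Exc], since its vertices have two links inside their copies of K4. Each [b]
    value on [Exc] is taken there at most twice, at vertices of weight at most 2, which makes 4. *)
Lemma total_wt_Exc : total_wt wt S0 <= total_wt wt (S0 :\: Exc) + 4 * #|b @: Exc|.
Proof.
rewrite (total_wtD wtC ExcS) leq_add2l.
apply: (@leq_trans (\sum_(x in Exc) 2)).
  apply: leq_sum => x xE; have xS := subsetP ExcS _ xE.
  rewrite [X in _ + X]big1 ?addn0; first exact: row2.
  move=> w /setDP [wS wE]; apply/eqP; rewrite -leqn0 leqNgt; apply/negP=> xw.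
  have /ExcP [v1 [v2 [v3 H]]] := xE.
  have H1 := linked_K4_rot H; have H3 := linked_K4_rot (linked_K4_rot H1).
  have [v1E v3E] : v1 \in Exc /\ v3 \in Exc.
    by split; apply/ExcP; [exists v2, v3, x | exists x, v1, v2].
  have [w1 w3] : v1 != w /\ v3 != w by split; apply: contraNneq wE => <-.
  case/and5P: H => aS uv l01 l12 /and4P [l23 l30 _ _].
  move: aS => /= /and5P [_ v1S v2S v3S _].
  have v13 : v1 != v3 by move: uv; rewrite /= !inE !negb_or => /and3P [_ /andP []].
  by case/negP: (three_links (And4 xS v1S v3S wS) v13 w1 w3 l01 (etrans (linkC _ _) l30)).
rewrite (partition_big_imset b) /=.
apply: (@leq_trans (\sum_(y in b @: Exc) 4)); last by rewrite sum_nat_const mulnC.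
apply: leq_sum => y /imsetP [v vE ->].
have /ExcP [v1 [v2 [v3 H]]] := vE.
rewrite sum_nat_const -[4]/(2 * 2) leq_mul2r /=.
apply: leq_trans (_ : #|[set v; v2]| <= 2); last by rewrite cards2; case: (_ != _).
apply: subset_leq_card; apply/subsetP=> u; rewrite -topredE /= => /andP [uE /eqP bu].
by rewrite !inE; apply: linked_K4_fibre H _ bu; apply: (subsetP ExcS).
Qed.

(** On an even cycle of links, vertices two apart are [near] but have no third link, so [v0], [v2]
    and [v1], [v3] agree in [b]. These four form a copy of K4, although the cycle avoids [Exc]. *)
Lemma no_even_link_cycle p : cycle link p -> uniq p ->
  {subset p <= S0 :\: Exc} -> 3 < size p -> odd (size p).
Proof.
move=> cp up pS sp; apply: contraT => evp.
case: p => [|v0 [|v1 [|v2 [|v3 q]]]] // in cp up pS sp evp *.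
have pS0 : {subset [:: v0, v1, v2, v3 & q] <= S0} by move=> x /pS /setDP [].
have cn : cycle near [:: v0, v1, v2, v3 & q].
  have : {in S0 &, subrel link near} by move=> x y xS yS; apply: link_near.
  move/sub_in_cycle; apply=> //.
  by apply/allP => x /pS0.
have [v0S v1S v2S v3S] : [/\ v0 \in S0, v1 \in S0, v2 \in S0 & v3 \in S0].
  by split; apply: pS0; rewrite !inE eqxx ?orbT.
have [l01 l12 l23] : [/\ link v0 v1, link v1 v2 & link v2 v3].
  by move: cp => /= /and4P [].
have tS : last v3 q \in S0 by apply: pS0; rewrite 3!in_cons mem_last !orbT.
have lt0 : link v0 (last v3 q).
  by move: cp; rewrite linkC /= rcons_path => /and4P [_ _ _ /andP []].
have [u01 u02 u12 u13] : [/\ v0 != v1, v0 != v2, v1 != v2 & v1 != v3].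
  move: up; rewrite /= !inE !negb_or.
  by case/and3P=> /and4P [-> -> _ _] /and3P [-> -> _] _.
have [u03 u23] : v0 != v3 /\ v2 != v3.
  by move: up; rewrite /= !inE !negb_or => /and3P [/and4P [_ _ -> _] _ /andP [/andP [-> _] _]].
have [t1 t2] : v1 != last v3 q /\ v2 != last v3 q.
  move: up; rewrite /= => /and4P [_ h1 h2 _].
  split; first by apply: contraNneq h1 => ->; rewrite in_cons mem_last orbT.
  by apply: contraNneq h2 => ->; rewrite mem_last.
have near02 : near v0 v2.
  apply: (@no_even_cycle v0 v1 v2 (v3 :: q)) => //; first by move: evp; rewrite /= !negbK.
  by exists v0, v1; rewrite !inE !eqxx ?orbT.
have near13 : near v1 v3.
  apply: (@no_even_cycle v1 v2 v3 (rcons q v0)).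
  - by rewrite -[[:: _, _, _ & _]]/(rcons [:: v1, v2, v3 & q] v0) -rot1_cons rot_cycle.
  - by rewrite -[[:: _, _, _ & _]]/(rcons [:: v1, v2, v3 & q] v0) -rot1_cons rot_uniq.
  - move=> x; rewrite -[[:: _, _, _ & _]]/(rcons [:: v1, v2, v3 & q] v0) -rot1_cons mem_rot.
    exact: pS0.
  - by move: evp; rewrite size_rcons /= !negbK.
  - by exists v1, v2; rewrite !inE !eqxx ?orbT.
have b02 : b v0 = b v2.
  by apply: near_b => //; apply: (three_links (x := v1) (y := last v3 q)); rewrite // eq_sym.
have b13 : b v1 = b v3.
  by apply: near_b => //; apply: (three_links (x := v0) (y := v2)); rewrite // linkC.
(* In the order [v1], [v0], [v2], [v3], links alternate with pairs of equal [b]. *)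
have : linked_K4 v2 v3 v0 v1.
  apply: (@mixed_even_cycle v1 v0 v2 v3 [::]) => //.
  - rewrite /= near02 link_near 1?linkC // link_near // same_near //.
    by rewrite eq_sym.
  - by rewrite /= !inE !negb_or eq_sym u01 u12 u13 u02 u03 u23.
  - by move=> x; rewrite !inE => /or4P [] /eqP ->.
  - by rewrite linkC.
move=> H; have : v2 \in Exc by apply/ExcP; exists v3, v0, v1.
by have /pS/setDP [_ /negP] : v2 \in [:: v0, v1, v2, v3 & q] by rewrite !inE eqxx !orbT.
Qed.

(** * Absence of alternating cycles among the connectors *)

Section Alternating.

Variables (S : {set V}) (kap : V -> V).
Hypothesis con : connectors wt (S0 :\: Exc) S kap.

Let SS0 x : x \in S -> x \in S0.
Proof. by case: con => /subsetP sub _ _ _ /sub /setDP []. Qed.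

(* The two end links recorded here are those that [mixed_even_cycle] needs. *)
Lemma alternating_near_path p l :
  all (kap_pair kap S) (p :: l) -> path (fun p q => b p.2 == b q.1) p l ->
  uniq [seq kap q.1 | q <- p :: l] ->
  exists m w' y z, [/\ p.1 :: y :: z = rcons (rcons m w') (last p l).2,
    link w' (last p l).2 /\ link p.1 y, path near p.1 (y :: z),
    uniq (p.1 :: y :: z) /\ ~~ odd (size z) &
    {in p.1 :: y :: z, forall x, (x \in S) && (kap x \in [seq kap q.1 | q <- p :: l])}].
Proof.
case: con => _ _ _ conS.
elim: l p => [|p' l IH] p.
  move=> /= /andP [/and4P [p1S p2S p12 /eqP kp] _] _ _.
  have [q [pq lq uq oq qS]] := conS _ _ p1S p2S p12 kp.
  have pn : path near p.1 q.
    have : {in S0 &, subrel link near} by move=> x y xS yS; apply: link_near.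
    move/sub_in_path; apply=> //.
    by apply/allP => x /qS /andP [/SS0].
  case: q => [|y z] // in pq lq uq oq qS pn *.
  exists (belast p.1 (belast y z)), (last p.1 (belast y z)), y, z; split=> //=.
  - by rewrite -lastI rcons_cons -lq /= -lastI.
  - have /= /andP [p1y _] := pq; split=> //.
    by move: pq; rewrite (lastI y z) (lq : last y z = p.2) rcons_path => /andP [].
  - by move=> x /qS /andP [-> /eqP ->]; rewrite inE eqxx.
rewrite [all _ _]/= => /andP [/and4P [p1S p2S p12 /eqP kp] al].
rewrite [path _ _ _]/= => /andP [/eqP pp' pl] ul.
have kN : kap p.1 \notin [seq kap q.1 | q <- p' :: l] by case/andP: ul.
have {}ul : uniq [seq kap q.1 | q <- p' :: l] by case/andP: ul.
have [m [w' [y [z [Ez [lw' py] pn [uz oz] zS]]]]] := IH p' al pl ul.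
have [q [pq lq uq oq qS]] := conS _ _ p1S p2S p12 kp.
have qn : path near p.1 q.
  have : {in S0 &, subrel link near} by move=> u v uS vS; apply: link_near.
  move/sub_in_path; apply=> //.
  by apply/allP => x /qS /andP [/SS0].
have disj x : x \in p'.1 :: y :: z -> x \notin p.1 :: q.
  move=> /zS /andP [_ kx]; apply: contraNN kN => /qS /andP [_ /eqP <-].
  exact: kx.
have p'z : p'.1 \in p'.1 :: y :: z by rewrite inE eqxx.
have nearp : near p.2 p'.1.
  apply: same_near => //; first exact: SS0.
    by have /zS /andP [/SS0] := p'z.
  by apply: contraNneq (disj _ p'z) => <-; rewrite -lq mem_last.
case: q => [|y' q] // in pq lq uq oq qS qn disj *.
exists (p.1 :: y' :: q ++ m), w', y', (q ++ p'.1 :: y :: z); split.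
- by rewrite Ez /= !rcons_cat.
- by split=> //; case/andP: pq.
- rewrite -cat_cons cat_path qn /= [last _ _]lq nearp /=.
  exact: pn.
- split; last by move: oq oz; rewrite !size_cat /= oddD /= => /negPf -> ; rewrite negbK.
  rewrite -[p.1 :: _]/((p.1 :: y' :: q) ++ (p'.1 :: y :: z)) cat_uniq uq uz andbT.
  by rewrite andTb; apply/hasPn => x /disj.
- move=> x; rewrite -[p.1 :: _]/((p.1 :: y' :: q) ++ (p'.1 :: y :: z)) mem_cat.
  case/orP=> [/qS /andP [-> /eqP ->]|/zS /andP [-> kx]]; first by rewrite inE eqxx.
  by rewrite /= in_cons kx orbT.
Qed.

(** Each pair expands to a path of links on an even number of vertices of its class, and equal [b]
    joins consecutive paths. The resulting even cycle of [near] would be a copy of K4, but [S]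
    avoids [Exc]. *)
Lemma no_alternating_cycle l : ~ alternating_cycle b kap S l.
Proof.
case=> + al ul; case: l al ul => // p l al ul _ /= cl.
have {}cl : path (fun p q => b p.2 == b q.1) p l /\ b (last p l).2 == b p.1.
  by move: cl; rewrite rcons_path => /andP.
case: cl => pl /eqP bl.
have [m [w' [y [z [Ez [lw' py] pn [uz oz] zS]]]]] := alternating_near_path al pl ul.
have zS0 x : x \in p.1 :: y :: z -> x \in S0 by move=> /zS /andP [/SS0].
have p1z : p.1 \in p.1 :: y :: z by rewrite inE eqxx.
have yz : y \in p.1 :: y :: z by rewrite !inE eqxx orbT.
have szZ : (size z).+2 = (size m).+2 by have := congr1 size Ez; rewrite /= !size_rcons.
have lS : (last p l).2 \in S0.
  by apply: zS0; rewrite Ez mem_rcons inE eqxx.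
(* Two vertices would be linked with equal [b], and three vertices contradict the parity. *)
case: m Ez szZ => [|v m].
  case=> _ yw _ _; have := link_b (zS0 _ p1z) (zS0 _ yz) py.
  by rewrite yw bl eqxx.
case: m => [|y' q].
  by case=> _ _ Ez [szz]; rewrite szz in oz.
case=> <- <- Ez _.
set w := (last p l).2 in Ez lw' bl lS.
have EZ : p.1 :: y :: z = (p.1 :: y :: q) ++ [:: w'; w] by rewrite Ez -!cats1 -catA.
have Erot : rot (size (p.1 :: y :: q)) (p.1 :: y :: z) = [:: w', w, p.1, y & q].
  by rewrite EZ rot_size_cat.
have cyc : cycle near (p.1 :: y :: z).
  rewrite /cycle rcons_path pn Ez -!cats1 -catA /= last_cat /=.
  have wp1 : w != p.1.
    apply: contraTneq uz => wE; rewrite EZ cat_uniq negb_and; apply/orP; right.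
    rewrite negb_and; apply/orP; left; rewrite negbK; apply/hasP; exists w.
      by rewrite !inE eqxx orbT.
    by rewrite wE inE eqxx.
  by rewrite same_near // zS0.
have H : linked_K4 p.1 y w w'.
  apply: (@mixed_even_cycle w' w p.1 y q) => //.
  - by rewrite -Erot rot_cycle.
  - by rewrite -Erot rot_uniq.
  - by move=> x; rewrite -Erot mem_rot; apply: zS0.
  - by move: oz; rewrite Ez size_rcons size_rcons /= negbK.
have p1E : p.1 \in Exc by apply/ExcP; exists y, w, w'.
have /zS /andP [p1S _] := p1z.
by case: con => /subsetP sub _ _ _; have /setDP [_ /negP] := sub _ p1S.
Qed.

End Alternating.

(** Outside [Exc] the weight is at most 4 times the excess of [#|S|] over the number of classes, and
    the forest bound makes this excess at most the number of [b] values on [S]. By [linked_K4_fibre]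
    these differ from the values on [Exc]. *)
Theorem total_wt_le : total_wt wt S0 <= 4 * #|b @: S0|.
Proof.
have row2' : {in S0 :\: Exc, forall v, \sum_(w in S0 :\: Exc) wt v w <= 2}.
  move=> v /setDP [vS _]; apply: leq_trans (row2 vS).
  by rewrite [leqRHS](big_setID Exc) /= leq_addl.
have [S [kap con]] := connectors_exist wtC wt0 row2' no_even_link_cycle.
have leS := card_le_of_no_alternating_cycle (no_alternating_cycle con).
have [SW _ le _] := con.
have leb : #|b @: S| + #|b @: Exc| <= #|b @: S0|.
  rewrite -cardsUI [b @: S :&: _](_ : _ = set0) ?cards0 ?addn0.
    rewrite -imsetU; apply: subset_leq_card; apply: imsetS.
    by rewrite subUset ExcS andbT; apply: subset_trans SW _; apply: subsetDl.
  apply/setP=> y; rewrite !inE; apply/negP=> /andP [/imsetP [x xS ->]].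
  case/imsetP=> v /[dup] vE /ExcP [v1 [v2 [v3 H]]] bx.
  have /setDP [xS0 /negP xE] := subsetP SW _ xS.
  case/orP: (linked_K4_fibre H xS0 bx) => /eqP xv; apply: xE; rewrite xv //.
  by apply/ExcP; exists v3, v, v1; do 2!apply: linked_K4_rot.
by move: total_wt_Exc le leS leb; clear; lia.
Qed.

End Counting.

(** * Distance at most 2 and deletion of an edge *)

Definition near (V : finType) (e : rel V) : rel V :=
  fun v w => (v != w) && (e v w || [exists z, e v z && e z w]).

Definition del_edge (V : finType) (e : rel V) (u v : V) : rel V :=
  fun x y => e x y && ~~ ((x == u) && (y == v) || (x == v) && (y == u)).

(** * Edge-critical graphs *)

Section Near.

Variables (V : finType) (e : rel V).
Hypotheses (esym : symmetric e) (eirr : irreflexive e).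

Lemma near_sym : symmetric (near e).
Proof.
move=> x y; rewrite /near eq_sym esym; congr (_ && (_ || _)).
by apply: eq_existsb => z; rewrite (esym x z) (esym z y) andbC.
Qed.

Lemma near_irr : irreflexive (near e).
Proof. by move=> x; rewrite /near eqxx. Qed.

Lemma nearP v w : reflect (v <> w /\ (e v w \/ exists z, e v z /\ e z w)) (near e v w).
Proof.
apply: (iffP andP) => [[/eqP vw /orP [evw|/existsP [z /andP [vz zw]]]]|].
- by split; last left.
- by split; last by right; exists z.
- case=> /eqP vw [->|[z [vz zw]]]; split=> //.
  by apply/orP; right; apply/existsP; exists z; rewrite vz.
Qed.

Lemma del_edge_sym u v : symmetric (del_edge e u v).
Proof. by move=> x y; rewrite /del_edge esym [(x == u) && _]andbC [(x == v) && _]andbC orbC. Qed.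

Lemma del_edge_irr u v : irreflexive (del_edge e u v).
Proof. by move=> x; rewrite /del_edge eirr. Qed.

End Near.

(** Every edge on a path of length at most 2 from [x] to [y] ends in [x] or [y], so it is not
    [u v]. *)
Lemma near_del_edge (V : finType) (e : rel V) u v x y :
  x \notin [set u; v] -> y \notin [set u; v] ->
  near e x y -> near (del_edge e u v) x y.
Proof.
rewrite !inE !negb_or => /andP [/negPf xu /negPf xv] /andP [/negPf yu /negPf yv].
case/nearP=> xy h; apply/nearP; split=> //.
case: h => [exy|[z [xz zy]]].
  by left; rewrite /del_edge exy xu xv.
by right; exists z; rewrite /del_edge xz zy xu xv yu yv !andbF.
Qed.

(** * The core of an edge-minimal counterexample *)

Section Critical.

Variables (V : finType) (C : eqType) (e : rel V) (L : V -> seq C) (k : nat).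
Hypotheses (esym : symmetric e) (eirr : irreflexive e).
Hypothesis Lk : forall v, uniq (L v) /\ size (L v) = k + 2.
Hypothesis noc : ~ exists f, proper_on (near e) L setT f.
Hypothesis min_e : forall u v, e u v ->
  exists f, proper_on (near (del_edge e u v)) L setT f.
Hypothesis degk : forall v, #|[set w | e v w]| <= k.

Let nsym := near_sym esym.
Let nirr := near_irr e.

(** A vertex of degree 1 is not the middle of a path, so deleting its edge keeps [near] among the
    others; it sees at most [u] and the neighbours of [u], fewer than [k + 2] vertices. *)
Lemma degree_neq1 v : #|[set w | e v w]| != 1.
Proof.
apply/negP=> /cards1P [u Nv].
have vw w : e v w = (w == u) by move/setP/(_ w): Nv; rewrite !inE.
have evu : e v u by rewrite vw.
have [f [fL fP]] := min_e evu.
have p1 : proper_on (near e) L [set~ v] f.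
  split=> [x _|x y]; first exact: fL.
  rewrite !inE => xv yv /nearP [xy h]; apply: fP; rewrite ?inE //.
  apply/nearP; split=> //; case: h => [exy|[z [xz zy]]].
    by left; rewrite /del_edge exy (negPf xv) (negPf yv) andbF.
  have zv : z != v.
    apply: contra_not_neq xy => zv; rewrite zv in xz zy.
    by move: xz zy; rewrite esym !vw => /eqP -> /eqP ->.
  by right; exists z; rewrite /del_edge xz zy (negPf xv) (negPf yv) (negPf zv) !andbF.
have [uL sL] := Lk v.
have [||f' [f'P _]] := extend_proper_lt nsym nirr p1 (v := v) _ _ uL.
- by rewrite !inE eqxx.
- rewrite sL addn2 ltnS.
  apply: (@leq_trans #|u |: [set w | e u w]|); last first.
    by rewrite cardsU1 -add1n leq_add ?degk //; case: (_ \notin _).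
  apply: subset_leq_card; apply/subsetP=> w; rewrite !inE.
  case/andP=> wv /nearP [_ [|[z [+ zw]]]]; rewrite vw; first by move=> ->.
  by move=> /eqP zu; rewrite -zu zw orbT.
apply: noc; exists f'; apply: proper_onS f'P.
by apply/subsetP=> w _; rewrite !inE orbN.
Qed.

Definition in_core (W : {set V}) :=
  [forall v in W, k + 2 <= #|[set w in W | near e v w]|].

Definition core : {set V} := \bigcup_(W : {set V} | in_core W) W.

Lemma core_degree v : v \in core -> k + 2 <= #|[set w in core | near e v w]|.
Proof.
case/bigcupP=> W Wc vW; apply: leq_trans (forall_inP Wc v vW) _.
apply: subset_leq_card; apply/subsetP=> w; rewrite !inE => /andP [wW ->].
by rewrite andbT; apply/bigcupP; exists W.
Qed.

Lemma core_max W : in_core W -> W \subset core.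
Proof. by move=> Wc; apply/subsetP=> x xW; apply/bigcupP; exists W. Qed.

(** Unless [W] lies in the core, some vertex of [W] has fewer than [k + 2] vertices of [W] near it;
    it is outside the core and can be coloured last. *)
Lemma extend_from_core f (W : {set V}) : core \subset W ->
  proper_on (near e) L core f ->
  exists f', proper_on (near e) L W f'.
Proof.
move=> + fc; have [n] := ubnP #|W|; elim: n W => // n IH W; rewrite ltnS => leW cW.
have [Wc|] := boolP (in_core W); first by exists f; apply: proper_onS fc; apply: core_max.
rewrite negb_forall_in => /exists_inP [v vW]; rewrite -ltnNge => lt.
have vc : v \notin core.
  apply: contraL lt => vc; rewrite -leqNgt; apply: leq_trans (core_degree vc) _.
  apply: subset_leq_card; apply/subsetP=> w; rewrite !inE => /andP [wc ->].
  by rewrite (subsetP cW).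
have [|| f1 f1P] := IH (W :\ v).
- by move: leW; rewrite (cardsD1 v) vW.
- by rewrite subsetD1 cW.
have [uL sL] := Lk v.
have [||f' [f'P _]] := extend_proper_lt nsym nirr f1P (v := v) _ _ uL.
- by rewrite !inE eqxx.
- rewrite sL; apply: leq_ltn_trans lt; apply: subset_leq_card.
  by apply/subsetP=> w; rewrite !inE => /andP [/andP [_ ->]].
by exists f'; apply: proper_onS f'P; rewrite setD1K.
Qed.

(* Colour the graph minus [u v], erase the colours on [U] and outside the core,
   and let [L'] be the lists of colours still available. *)
Lemma core_lists (U : {set V}) u v : U \subset core -> e u v ->
  (u \in U) || (u \notin core) -> (v \in U) || (v \notin core) ->
  exists (c0 : V -> C) (L' : V -> seq C),
    (forall x, uniq (L' x) /\
       k + 2 <= size (L' x) + #|[set w in core :\: U | near e x w]|) /\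
    ~ exists f, proper_on (near e) L' U f.
Proof.
move=> Uc euv uU vU.
have [c [cL cP]] := min_e euv.
pose s x := [seq c w | w <- enum [set w in core :\: U | near e x w]].
pose L' x := [seq a <- L x | a \notin s x].
(* Neither [u] nor [v] is in [core :\: U], so restoring their edge creates no new conflict there. *)
have cD x y : x \in core :\: U -> y \in core :\: U -> near e x y -> c x != c y.
  have notuv z : z \in core :\: U -> z \notin [set u; v].
    rewrite !inE => /andP [zU zc]; apply/norP; split.
      by apply: contraTneq uU => <-; rewrite (negPf zU) zc.
    by apply: contraTneq vU => <-; rewrite (negPf zU) zc.
  move=> xD yD xy; apply: cP; rewrite ?inE //.
  by apply: near_del_edge; rewrite ?notuv.
exists c, L'; split.
  move=> x; have [uL sL] := Lk x; split; first exact: filter_uniq.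
  rewrite -sL -(count_predC (fun a => a \notin s x)) size_filter leq_add2l.
  rewrite (eq_count (a2 := mem (s x))); last by move=> a; rewrite /= negbK.
  rewrite -size_filter; apply: (@leq_trans (size (s x))); last by rewrite size_map -cardE.
  apply: uniq_leq_size; first exact: filter_uniq.
  by move=> a; rewrite mem_filter => /andP [].
case=> f [fL fP].
have [|f' f'P] := @extend_from_core (fun x => if x \in U then f x else c x) setT (subsetT _).
  split=> [x xc|x y xc yc xy].
    case: ifP => [/fL|_]; last exact: cL.
    by rewrite mem_filter => /andP [].
  have fc a b : a \in U -> b \in core -> b \notin U -> near e a b -> f a != c b.
    move=> aU bc bU ab; have := fL _ aU; rewrite mem_filter => /andP [+ _].
    by apply: contraNneq => ->; apply: map_f; rewrite mem_enum !inE bU bc.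
  case: ifP => xU; case: ifP => yU.
  - exact: fP.
  - by apply: fc; rewrite ?yU.
  - by rewrite eq_sym; apply: fc; rewrite ?xU // nsym.
  - by apply: cD; rewrite // !inE ?xU ?yU.
by apply: noc; exists f'.
Qed.

(** With [U] empty, [core_lists] would make the empty set uncolourable. *)
Lemma compl_core_indep u v : e u v -> (u \in core) || (v \in core).
Proof.
move=> euv; apply: contraT; rewrite negb_or => /andP [uc vc].
have [|| c0 [L' [_ []]]] := core_lists (sub0set _) euv; rewrite ?uc ?vc ?orbT //.
by exists c0; split=> x; rewrite inE.
Qed.

(** Uncolour the cycle: with at most [k + 2] core vertices near each of its vertices, the remaining
    lists are as long as [color_even_cycle] requires. The edge [u v] is the one deleted, hence the
    condition on its ends. *)
Lemma core_no_even_cycle a x c q u v :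
  let p := [:: a, x, c & q] in
  cycle (near e) p -> uniq p -> odd (size q) ->
  {in p, forall y, y \in core /\ #|[set w in core | near e y w]| <= k + 2} ->
  e u v -> (u \in p) || (u \notin core) -> (v \in p) || (v \notin core) ->
  near e a c.
Proof.
move=> p cp up oq pc euv uU vU; apply: contraT => nac.
pose U := [set y in p].
have Uc : U \subset core by apply/subsetP=> y; rewrite inE => /pc [].
have [|| c0 [L' [L'P noL']]] := core_lists Uc euv; rewrite ?in_set //.
exfalso; apply: (@color_even_cycle V C (near e) L' nsym nirr U _ c0 a x c q) noL' => //.
- move=> y; rewrite inE => yp; have [uL sL] := L'P y; split=> //.
  have [yc le] := pc _ yp.
  have E : #|[set w in core | near e y w]| =
      #|[set w in U | near e y w]| + #|[set w in core :\: U | near e y w]|.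
    rewrite -(cardsID U); congr addn; apply: eq_card => w.
      rewrite in_setI !in_set [in RHS]andbC -andbA [in RHS]andbC.
      by case wp: (w \in p); rewrite ?andbF ?andbT //; have [-> _] := pc _ wp.
    by rewrite !inE andbA.
  by move: sL le; rewrite E; clear; lia.
- by move=> y; rewrite in_set.
Qed.

End Critical.

Lemma card_bigcup_le (I T : finType) (P : {pred I}) (F : I -> {set T}) :
  #|\bigcup_(i in P) F i| <= \sum_(i in P) #|F i|.
Proof.
apply: (big_ind2 (fun (A : {set T}) n => #|A| <= n)) => //; first by rewrite cards0.
move=> A m B n Am Bn; apply: leq_trans (leq_add Am Bn).
by rewrite cardsU leq_subr.
Qed.

Lemma card_set_sum (T : finType) (A : {set T}) (P : pred T) :
  #|[set x in A | P x]| = \sum_(x in A) (P x : nat).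
Proof.
rewrite -sum1_card big_mkcond [RHS]big_mkcond; apply: eq_bigr => x _.
by rewrite inE; case: (x \in A) => //=; case: (P x).
Qed.

(** * Special vertices and discharging *)

Section Structure.

Variables (V : finType) (e : rel V) (k : nat) (R : {set V}).
Hypotheses (esym : symmetric e) (eirr : irreflexive e) (k17 : 17 <= k).
Local Notation nb v := [set w | e v w].
Local Notation deg v := #|[set w | e v w]|.
Hypothesis degk : forall v, deg v <= k.
Hypothesis deg_neq1 : forall v, deg v != 1.
Hypothesis coR_indep : forall u v, e u v -> (u \in R) || (v \in R).
Hypothesis R_degree : forall v, v \in R -> k + 2 <= #|[set w in R | near e v w]|.
Hypothesis R_no_even_cycle : forall a x c q u v,
  let p := [:: a, x, c & q] in
  cycle (near e) p -> uniq p -> odd (size q) ->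
  {in p, forall y, y \in R /\ #|[set w in R | near e y w]| <= k + 2} ->
  e u v -> (u \in p) || (u \notin R) -> (v \in p) || (v \notin R) ->
  near e a c.

(* How many vertices of [R] a vertex [v] of [R] can see within distance 2 through
   its neighbour [w], counting [w] if it is in [R] but not [v]. *)
Definition contribution (w : V) : nat := #|nb w :&: R| - (w \notin R).
Local Notation t := contribution.

Definition branch (v w : V) : {set V} :=
  (if w \in R then [set w] else set0) :|: (nb w :&: R) :\ v.

Lemma mem_branch v w x : (x \in branch v w) =
  (x \in R) && ((x == w) || (x != v) && e w x).
Proof.
rewrite /branch in_setU; case: ifP => wR; rewrite !inE.
  case: (eqVneq x w) => [->|_]; first by rewrite wR.
  by case: (x \in R); case: (x != v); case: (e w x).
case: (eqVneq x w) => [->|_]; first by rewrite wR !andbF.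
by case: (x \in R); case: (x != v); case: (e w x).
Qed.

Lemma near_branch v :
  [set w in R | near e v w] \subset \bigcup_(w in nb v) branch v w.
Proof.
apply/subsetP=> x; rewrite inE => /andP [xR /nearP [vx h]]; apply/bigcupP.
case: h => [evx|[z [vz zx]]].
  by exists x; [rewrite inE | rewrite mem_branch xR eqxx].
exists z; first by rewrite inE.
rewrite mem_branch xR zx andbT.
by apply/orP; right; apply/eqP=> xv; apply: vx.
Qed.

Lemma card_branch v w : v \in R -> e v w -> #|branch v w| <= t w.
Proof.
move=> vR vw; rewrite /branch /t.
have vN : v \in nb w :&: R by rewrite !inE vR esym vw.
rewrite (cardsD1 v (nb w :&: R)) vN /=; apply: leq_trans (leq_card_setU _ _) _.
by case: (w \in R); rewrite /= ?cards1 ?cards0 /=; lia.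
Qed.

Lemma near_le v : v \in R ->
  #|[set w in R | near e v w]| <= \sum_(w in nb v) t w.
Proof.
move=> vR; apply: leq_trans (subset_leq_card (near_branch v)) _.
apply: leq_trans (card_bigcup_le _ _) _; apply: leq_sum => w.
by rewrite inE; apply: card_branch.
Qed.

Lemma sum_contribution v : v \in R -> k + 2 <= \sum_(w in nb v) t w.
Proof. by move=> vR; apply: leq_trans (R_degree vR) (near_le vR). Qed.

(** A vertex counted in two branches would leave fewer than [k + 2] vertices of [R] near [v]. *)
Lemma branch_disjoint v w w' x : v \in R -> \sum_(w in nb v) t w <= k + 2 ->
  e v w -> e v w' -> w != w' -> x \in branch v w -> x \notin branch v w'.
Proof.
move=> vR le vw vw' ww' xw; apply/negP=> xw'.
have wN : w \in nb v by rewrite inE.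
have w'N : w' \in nb v :\ w by rewrite !inE eq_sym ww' vw'.
suff : #|[set w in R | near e v w]| < \sum_(w in nb v) t w.
  by have := R_degree vR; lia.
apply: leq_ltn_trans (subset_leq_card (near_branch v)) _.
rewrite (big_setD1 w wN) (big_setD1 w' w'N) /= [X in _ < X](big_setD1 w wN).
rewrite /= [X in _ < _ + X](big_setD1 w' w'N) /= setUA.
apply: leq_ltn_trans (leq_card_setU _ _) _; rewrite addnA -addSn; apply: leq_add.
  rewrite cardsU; have : 0 < #|branch v w :&: branch v w'|.
    by rewrite card_gt0; apply/set0Pn; exists x; rewrite inE xw.
  have : #|branch v w :&: branch v w'| <= #|branch v w|.
    by apply: subset_leq_card; apply: subsetIl.
  have := card_branch vR vw; have := card_branch vR vw'; lia.
apply: leq_trans (card_bigcup_le _ _) _; apply: leq_sum => z.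
by rewrite !inE => /and3P [_ _]; apply: card_branch.
Qed.

Lemma contribution_le w : t w <= deg w - (w \notin R).
Proof. by rewrite /t leq_sub2r // subset_leq_card // subsetIl. Qed.

(** * Hubs and vertices of degree 2 or 3 *)

Definition full B := [&& B \in R, deg B == k & nb B \subset R].
Definition T2 u := (u \notin R) && (deg u == 2).
Definition T3 u := (u \notin R) && (deg u == 3).
Definition R2 u := (u \in R) && (deg u == 2).

Lemma contribution_full w : k <= t w -> full w.
Proof.
move=> le; have := contribution_le w; have := degk w; rewrite /full.
case wR: (w \in R) => /=; last by lia.
move=> dk tk; have dw : deg w = k by lia.
rewrite dw eqxx /=; apply/setIidPl/eqP; rewrite eqEcard subsetIl /= dw.
by move: le; rewrite /t wR subn0.
Qed.

Lemma full_contribution w : full w -> t w = k.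
Proof. by case/and3P=> wR /eqP dw /setIidPl wN; rewrite /t wN dw wR subn0. Qed.

Lemma coR_contribution w : w \notin R -> t w = (deg w).-1.
Proof.
move=> wR; rewrite /t wR subn1; congr (_.-1); congr #|pred_of_set _|.
apply/setIidPl/subsetP=> x; rewrite inE => /coR_indep.
by rewrite (negPf wR).
Qed.

Lemma T2_contribution w : T2 w -> t w = 1.
Proof. by case/andP=> wR /eqP dw; rewrite coR_contribution // dw. Qed.

Lemma T3_contribution w : T3 w -> t w = 2.
Proof. by case/andP=> wR /eqP dw; rewrite coR_contribution // dw. Qed.

Lemma R2_contribution w : R2 w -> t w <= 2.
Proof. by case/andP=> wR /eqP dw; have := contribution_le w; rewrite dw wR. Qed.

Lemma coR_nb u v : u \notin R -> e u v -> v \in R.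
Proof. by move=> uR /coR_indep; rewrite (negPf uR). Qed.

Lemma deg2P v a : deg v = 2 -> e v a ->
  exists c, [/\ c != a, nb v = [set a; c] & e v c].
Proof.
move=> d2 va; have aN : a \in nb v by rewrite inE.
have : #|nb v :\ a| = 1 by move: d2; rewrite (cardsD1 a) aN; lia.
move/eqP/cards1P=> [c E]; have cN : c \in nb v :\ a by rewrite E inE.
exists c; move: (cN); rewrite !inE => /andP [-> ->]; split=> //.
by rewrite -E setD1K.
Qed.

Lemma sum_nb2 (F : V -> nat) v a c : c != a -> nb v = [set a; c] ->
  \sum_(w in nb v) F w = F a + F c.
Proof. by move=> ca ->; rewrite big_setU1 ?inE 1?eq_sym //= big_set1. Qed.

(* Exact count: every branch at these vertices attains its contribution and the
   branches are disjoint, so their number of core vertices within distance 2 is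
   exactly [k + 2]. *)
Definition tC v := [&& v \in R, deg v == 3, #|[set w in nb v | T2 w]| == 2 &
  [exists B in nb v, full B]].
Definition tD v := [&& R2 v, [exists w in nb v, T3 w] & [exists B in nb v, full B]].
Definition tA v := [&& R2 v, [exists w in nb v, R2 w] & [exists B in nb v, full B]].
Definition special : {set V} := [set v | [|| tC v, tD v | tA v]].
Definition hub v := odflt v [pick B in nb v | full B].

Lemma hubP v : v \in special -> e v (hub v) /\ full (hub v).
Proof.
rewrite inE => sv; have /exists_inP [B BN Bf] : [exists B in nb v, full B].
  by case/or3P: sv => /and3P [_ _] // /andP [].
rewrite /hub; case: pickP => [B' /andP []|/(_ B)]; first by rewrite inE.
by rewrite BN Bf.
Qed.

Lemma full_not2 w : full w -> 16 < deg w.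
Proof. by case/and3P=> _ /eqP ->. Qed.

Lemma tC_nb v : tC v -> exists u1 u2,
  [/\ u1 != u2, T2 u1, T2 u2 & nb v = [set u1; u2; hub v]].
Proof.
move=> Cv; have sv : v \in special by rewrite inE Cv.
have [vB fB] := hubP sv.
case/and4P: Cv => vR /eqP d3 /cards2P [u1 [u2 [u12 E]]] _.
have [T1 T2'] : (e v u1 && T2 u1) /\ (e v u2 && T2 u2).
  have : u1 \in [set u1; u2] /\ u2 \in [set u1; u2] by rewrite !inE !eqxx orbT.
  by rewrite -E !inE.
case/andP: T1 T2' => v1 T1 /andP [v2 T2'].
exists u1, u2; split=> //; apply/eqP; rewrite eq_sym eqEcard d3; apply/andP; split.
  by apply/subsetP=> x; rewrite !inE -orbA => /or3P [] /eqP ->.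
have h u : T2 u -> hub v != u.
  by case/andP=> _ /eqP du; apply/eqP=> E'; have := full_not2 fB; rewrite E' du.
by rewrite setUC cardsU1 cards2 u12 !inE negb_or !h.
Qed.

Lemma tD_nb v : tD v -> exists y, [/\ T3 y, hub v != y, e v y & nb v = [set y; hub v]].
Proof.
move=> Dv; have sv : v \in special by rewrite inE Dv orbT.
have [vB fB] := hubP sv.
case/and3P: Dv => /andP [_ /eqP d2] /exists_inP [y yN Ty] _.
rewrite inE in yN.
have [c [cy E vc]] := deg2P d2 yN.
have hy : hub v != y.
  by case/andP: Ty => _ /eqP dy; apply/eqP=> E'; have := full_not2 fB; rewrite E' dy.
exists y; split=> //; rewrite E; congr (_ |: [set _]).
have : hub v \in nb v by rewrite inE.
by rewrite E !inE (negPf hy) /= => /eqP.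
Qed.

Lemma tA_nb v : tA v -> exists a, [/\ R2 a, hub v != a, e v a & nb v = [set a; hub v]].
Proof.
move=> Av; have sv : v \in special by rewrite inE Av !orbT.
have [vB fB] := hubP sv.
case/and3P: Av => /andP [_ /eqP d2] /exists_inP [y yN Ty] _.
rewrite inE in yN.
have [c [cy E vc]] := deg2P d2 yN.
have hy : hub v != y.
  by case/andP: Ty => _ /eqP dy; apply/eqP=> E'; have := full_not2 fB; rewrite E' dy.
exists y; split=> //; rewrite E; congr (_ |: [set _]).
have : hub v \in nb v by rewrite inE.
by rewrite E !inE (negPf hy) /= => /eqP.
Qed.

Lemma special_sub : special \subset R.
Proof.
apply/subsetP=> v; rewrite inE.
by case/or3P=> [/and4P [] //|/and3P [/andP []] //|/and3P [/andP []] //].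
Qed.

Lemma special_sum v : v \in special -> \sum_(w in nb v) t w <= k + 2.
Proof.
move=> sv; have [vB fB] := hubP sv; have tB := full_contribution fB.
move: sv; rewrite inE => /or3P [Cv|/tD_nb [y [Ty hy _ E]]|/tA_nb [y [Ry hy _ E]]].
- have [u1 [u2 [u12 T1 T2' E]]] := tC_nb Cv.
  have hN : hub v \notin [set u1; u2].
    by rewrite !inE negb_or; apply/andP; split; apply/eqP=> E';
      have := full_not2 fB; rewrite E'; [case/andP: T1|case/andP: T2'] => _ /eqP ->.
  rewrite E setUC big_setU1 //= big_setU1 ?inE //= big_set1.
  by rewrite tB !T2_contribution.
- by rewrite (sum_nb2 _ hy E) tB T3_contribution // addnC.
- by rewrite (sum_nb2 _ hy E) tB addnC leq_add2l R2_contribution.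
Qed.

Lemma special_deg v : v \in special -> deg v <= 3.
Proof.
rewrite inE => /or3P [/and4P [_ /eqP -> _ _] //|/and3P [/andP [_ /eqP ->]] //|].
by case/and3P=> /andP [_ /eqP ->].
Qed.

Lemma R2_sum u a c : R2 u -> c != a -> nb u = [set a; c] -> k + 2 <= t a + t c.
Proof.
by move=> /andP [uR _] ca E; have := sum_contribution uR; rewrite (sum_nb2 _ ca E).
Qed.

(** [y] contributes just 2, so the other neighbour contributes [k] and is full; [R2_R2_tA] is
    similar. *)
Lemma R2_T3_tD v y : R2 v -> e v y -> T3 y -> tD v.
Proof.
move=> Rv vy Ty; have /andP [vR /eqP d2] := Rv.
have [c [cy E vc]] := deg2P d2 vy.
have := R2_sum Rv cy E; rewrite T3_contribution // => le.
rewrite /tD Rv /=; apply/andP; split; apply/exists_inP; first by exists y; rewrite ?inE.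
by exists c; rewrite ?inE //; apply: contribution_full; lia.
Qed.

Lemma R2_R2_tA v y : R2 v -> e v y -> R2 y -> tA v.
Proof.
move=> Rv vy Ry; have /andP [vR /eqP d2] := Rv.
have [c [cy E vc]] := deg2P d2 vy.
have := R2_sum Rv cy E; have := R2_contribution Ry => ty le.
rewrite /tA Rv /=; apply/andP; split; apply/exists_inP; first by exists y; rewrite ?inE.
by exists c; rewrite ?inE //; apply: contribution_full; lia.
Qed.

Lemma special_nb v z : v \in special -> e v z ->
  [\/ z = hub v, z \notin R | tA v /\ tA z].
Proof.
rewrite inE => sv vz; have zN : z \in nb v by rewrite inE.
case/or3P: sv => [/tC_nb [u1 [u2 [_ T1 T2' E]]]|/tD_nb [y [Ty hy _ E]]|].
- move: zN; rewrite E !inE -orbA => /or3P [] /eqP ->; last by apply: Or31.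
    by apply: Or32; case/andP: T1.
  by apply: Or32; case/andP: T2'.
- by move: zN; rewrite E !inE => /orP [] /eqP ->;
    [apply: Or32; case/andP: Ty|apply: Or31].
- move=> Av; have [y [Ry hy vy E]] := tA_nb Av.
  move: zN; rewrite E !inE => /orP [] /eqP ->; last by apply: Or31.
  have /and3P [Rv _ _] := Av.
  by apply: Or33; split=> //; apply: (R2_R2_tA (y := v)); rewrite // esym.
Qed.

Lemma special_coR v z : v \in special -> e v z -> z \notin R ->
  (tC v && T2 z) || (tD v && T3 z).
Proof.
rewrite inE => sv vz zR; have zN : z \in nb v by rewrite inE.
have hN x : full x -> z <> x by move=> /and3P [xR _ _] zx; rewrite zx xR in zR.
case/or3P: sv => [Cv|Dv|Av].
- have sv : v \in special by rewrite inE Cv.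
  have [u1 [u2 [_ T1 T2' E]]] := tC_nb Cv; rewrite Cv.
  move: zN; rewrite E !inE -orbA => /or3P [] /eqP zE; rewrite zE ?T1 ?T2' //.
  by case: (hN _ (proj2 (hubP sv))).
- have sv : v \in special by rewrite inE Dv orbT.
  have [y [Ty hy _ E]] := tD_nb Dv; rewrite Dv.
  move: zN; rewrite E !inE => /orP [] /eqP zE; rewrite zE ?Ty ?orbT //.
  by case: (hN _ (proj2 (hubP sv))).
- have sv : v \in special by rewrite inE Av !orbT.
  have [y [/andP [yR _] hy _ E]] := tA_nb Av.
  move: zN; rewrite E !inE => /orP [] /eqP zE; first by rewrite zE yR in zR.
  by case: (hN _ (proj2 (hubP sv))).
Qed.

Lemma not_T2_T3 z : T2 z -> T3 z -> False.
Proof. by case/andP=> _ /eqP d2 /andP [_]; rewrite d2. Qed.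

Lemma hub_notin v : v \in special -> hub v \notin special.
Proof.
move=> /hubP [_ fB]; apply/negP=> /special_deg; have := full_not2 fB; lia.
Qed.

Lemma tA_excl v : tA v -> (tC v = false) /\ (tD v = false).
Proof.
move=> Av; have /and3P [/andP [vR /eqP d2] _ _] := Av; split.
  by rewrite /tC d2 andbF.
apply/negP=> Dv; have [y [/andP [yR _] _ vy _]] := tD_nb Dv.
have [a [/andP [aR _] _ _ E]] := tA_nb Av.
have sv : v \in special by rewrite inE Av !orbT.
have /and3P [hR _ _] := proj2 (hubP sv).
have : y \in nb v by rewrite inE.
by rewrite E !inE => /orP [] /eqP yE; move: yR; rewrite yE ?aR ?hR.
Qed.

Lemma tD_excl v : tC v -> tD v = false.
Proof. by case/and4P=> _ /eqP d3 _ _; rewrite /tD /R2 d3 andbF. Qed.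

(** * Links between special vertices *)

Definition same_kind v w := (tC v && tC w) || (tD v && tD w).

(** These weights cover what special vertices lack after discharging, in tenths: 2 at each of two
    adjacent vertices of kind A, otherwise 1 per shared neighbour outside [R]. *)
Definition weight v w : nat :=
  if [&& tA v, tA w & e v w] then 2
  else if same_kind v w && (v != w) then #|(nb v :&: nb w) :\: R| else 0.

Lemma weightC v w : weight v w = weight w v.
Proof.
by rewrite /weight /same_kind (esym v w) (setIC (nb v)) (eq_sym v w)
  (andbCA (tA v)) (andbC (tC v)) (andbC (tD v)).
Qed.

Lemma weight0 v : weight v v = 0.
Proof. by rewrite /weight eirr eqxx !andbF. Qed.

Lemma weightP v w : wlink weight v w ->
  [/\ tA v, tA w & e v w] \/
  [/\ same_kind v w, v != w & exists z, [/\ e v z, e z w & z \notin R]].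
Proof.
rewrite /wlink /weight; case: ifP => [/and3P|_]; first by left.
case: ifP => // /andP [sk vw]; rewrite card_gt0 => /set0Pn [z].
by rewrite !inE => /and3P [zR vz wz]; right; split=> //;
  exists z; split=> //; rewrite esym.
Qed.

Lemma weight_intro v w z : same_kind v w -> v != w -> e v z -> e z w -> z \notin R ->
  wlink weight v w.
Proof.
move=> sk vw vz zw zR; rewrite /wlink /weight; case: ifP => // _.
by rewrite sk vw /= card_gt0; apply/set0Pn; exists z; rewrite !inE zR vz (esym w).
Qed.

(** Otherwise [v] would see [w] both through the hub and through the link, against
    [branch_disjoint]. *)
Lemma special_link_hub : {in special &, forall v w, wlink weight v w -> hub v != hub w}.
Proof.
move=> v w sv sw lk; apply/eqP=> hE.
have vR := subsetP special_sub _ sv; have wR := subsetP special_sub _ sw.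
have [vB _] := hubP sv; have [wB _] := hubP sw.
have BR : hub v \in R by case: (hubP sv) => _ /and3P [].
have vw : v != w by apply: contraTneq lk => ->; rewrite /wlink weight0.
have wB' : w \in branch v (hub v).
  by rewrite mem_branch wR [w == v]eq_sym vw hE (esym _ w) wB orbT.
have [z [vz zB wz]] : exists z, [/\ e v z, z != hub v & w \in branch v z].
  case: (weightP lk) => [[_ _ evw]|[_ _ [z [vz zw zR]]]].
    exists w; rewrite mem_branch wR eqxx; split=> //.
    by apply: contraNneq (hub_notin sv) => <-.
  exists z; rewrite mem_branch wR [w == v]eq_sym vw zw orbT; split=> //.
  by apply: contraNneq zR => ->.
by have := branch_disjoint vR (special_sum sv) vz vB zB wz; rewrite wB'.
Qed.

(** A common neighbour in [R] is the hub of both, since a neighbour of kind A has just one neighbour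
    besides its hub. A common neighbour outside [R] determines the kind by its degree: 2 for C, 3
    for D. *)
Lemma special_near : {in special &, forall v w,
  near e v w = (v != w) && ((hub v == hub w) || wlink weight v w)}.
Proof.
move=> v w sv sw; have [vB fB] := hubP sv; have [wB fB'] := hubP sw.
have wR := subsetP special_sub _ sw.
apply/nearP/andP=> [[/eqP vw h]|[/eqP vw /orP h]]; last first.
  split=> //; case: h => [/eqP hE|].
    by right; exists (hub v); rewrite {2}hE (esym _ w).
  case/weightP=> [[_ _ evw]|[_ _ [z [vz zw _]]]]; first by left.
  by right; exists z.
split=> //; case: h => [evw|[z [vz zw]]].
  case: (special_nb sv evw) => [wE|/negP //|[Av Aw]].
    by have := hub_notin sv; rewrite -wE sw.
  by rewrite /wlink /weight Av Aw evw orbT.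
have wz : e w z by rewrite esym.
have [zR|zR] := boolP (z \in R); last first.
  apply/orP; right; apply: (weight_intro (z := z)) => //.
  have := special_coR sv vz zR; have := special_coR sw wz zR.
  rewrite /same_kind => /orP [] /andP [-> Tz] /orP [] /andP [-> Tz'];
    rewrite ?orbT //; by case: (@not_T2_T3 z).
case: (special_nb sv vz) => [zE|/negP //|[Av Az]].
  case: (special_nb sw wz) => [zE'|/negP //|[Aw Az]].
    by rewrite -zE zE' eqxx.
  by have := hub_notin sv; rewrite -zE inE Az !orbT.
have sz : z \in special by rewrite inE Az !orbT.
have zv : e z v by rewrite esym.
have hN x : x \in special -> x != hub z by move=> sx; apply: contraNneq (hub_notin sz) => <-.
have [a [Ra ha za E]] := tA_nb Az.
have va : v = a.
  have : v \in nb z by rewrite inE.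
  by rewrite E !inE (negPf (hN _ sv)) orbF => /eqP.
have wa : w = a.
  have : w \in nb z by rewrite inE esym.
  by rewrite E !inE (negPf (hN _ sw)) orbF => /eqP.
by case/eqP: vw; rewrite va wa.
Qed.

Definition linked_count v z := #|[set w in nb z | (w != v) && same_kind v w]|.

Lemma sum_weight v : tC v || tD v ->
  \sum_(w in special) weight v w = \sum_(z in nb v :\: R) linked_count v z.
Proof.
move=> CDv; have nA : tA v = false.
  by apply/negP=> /tA_excl [C0 D0]; rewrite C0 D0 in CDv.
transitivity (\sum_(w in V | (w != v) && same_kind v w) \sum_(z in nb v :\: R) (e z w : nat)).
  rewrite big_mkcond [RHS]big_mkcond; apply: eq_bigr => w _ /=.
  rewrite /weight nA /= eq_sym andbC.
  case: ifP => [sw|sw]; last first.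
    case: ifP => // /andP [_ sk]; move: sw; rewrite inE.
    by case/orP: sk => /andP [_ ->]; rewrite ?orbT.
  case: ifP => // _; rewrite -card_set_sum; apply: eq_card => z.
  by rewrite !inE (esym w z) andbA.
rewrite exchange_big /=; apply: eq_bigr => z _.
rewrite /linked_count card_set_sum big_mkcond [RHS]big_mkcond; apply: eq_bigr => w _.
rewrite inE; case: (e z w); case: (_ && _) => //.
Qed.

(** Kind A has one partner, of weight 2. Kind C has two neighbours outside [R], each leading to one
    more vertex; kind D has one, leading to two. *)
Lemma special_row2 : {in special, forall v, \sum_(w in special) weight v w <= 2}.
Proof.
move=> v sv; have [vB fB] := hubP sv.
have hR : hub v \in R by case/and3P: fB.
have lc z : e v z -> linked_count v z <= (deg z).-1.
  move=> vz; have vN : v \in nb z by rewrite inE esym.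
  rewrite (cardsD1 v (nb z)) vN /=; apply: subset_leq_card.
  by apply/subsetP=> w; rewrite !inE => /and3P [-> -> _].
case/boolP: (tA v) => [Av|nAv].
  have [C0 D0] := tA_excl Av.
  have [a [Ra ha va E]] := tA_nb Av.
  rewrite (bigID (pred1 a)) /= [X in _ + X]big1 ?addn0.
    apply: (@leq_trans (\sum_(i | i == a) 2)); last by rewrite big_pred1_eq.
    rewrite big_mkcond [leqRHS]big_mkcond; apply: leq_sum => w _.
    case: eqVneq => [_|_]; rewrite ?andbF // andbT; case: ifP => // _.
    by rewrite /weight /same_kind C0 D0 /=; case: ifP.
  move=> w /andP [sw wa]; rewrite /weight /same_kind C0 D0 /=.
  case: ifP => // /and3P [_ _ vw].
  have : w \in nb v by rewrite inE.
  rewrite E !inE (negPf wa) /= => /eqP wE.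
  by have := hub_notin sv; rewrite -wE sw.
have CD : tC v || tD v by move: sv; rewrite inE (negPf nAv) orbF.
rewrite (sum_weight CD); case/orP: CD => [Cv|Dv].
  have [u1 [u2 [u12 T1 T2' E]]] := tC_nb Cv.
  apply: (@leq_trans (\sum_(z in nb v :\: R) 1)).
    apply: leq_sum => z; rewrite !inE => /andP [zR vz]; apply: leq_trans (lc _ vz) _.
    case/orP: (special_coR sv vz zR) => /andP [Dz Tz]; first by case/andP: Tz => _ /eqP ->.
    by case/andP: Tz; rewrite (tD_excl Cv) in Dz.
  rewrite sum1_card; apply: (@leq_trans #|[set u1; u2]|); last by rewrite cards2 u12.
  apply: subset_leq_card; apply/subsetP=> z; rewrite E in_setD in_setU => /andP [zR].
  by case/orP=> //; rewrite inE => /eqP zE; rewrite zE hR in zR.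
have [y [Ty hy vy E]] := tD_nb Dv; have /andP [yR /eqP dy] := Ty.
have -> : nb v :\: R = [set y].
  apply/setP=> z; rewrite in_setD E in_setU !in_set1.
  case: eqVneq => [->|_]; first by rewrite yR.
  by case: eqVneq => [->|_]; rewrite ?hR // andbF.
by rewrite big_set1; apply: leq_trans (lc _ vy) _; rewrite dy.
Qed.

Lemma special_total :
  \sum_(v in special) \sum_(w in special) weight v w <= 4 * #|[set B | full B]|.
Proof.
have H : total_wt weight special <= 4 * #|hub @: special|.
  apply: (total_wt_le (near := near e)); [exact: weightC|exact: weight0|
    exact: special_row2|exact: special_link_hub|exact: special_near|].
  move=> a x c q cp up ps oq [v [w [vp wp lk]]].
  have pc : {in [:: a, x, c & q], forall y,
      y \in R /\ #|[set w0 in R | near e y w0]| <= k + 2}.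
    move=> y /ps sy; have yR := subsetP special_sub _ sy; split=> //.
    exact: leq_trans (near_le yR) (special_sum sy).
  (* The link supplies the edge to delete: between two cycle vertices of kind A, or from a cycle
     vertex to a vertex outside [R]. *)
  case: (weightP lk) => [[_ _ vw]|[_ _ [z [vz _ zR]]]].
    by apply: (R_no_even_cycle cp up oq pc vw); rewrite ?vp ?wp.
  by apply: (R_no_even_cycle cp up oq pc vz); rewrite ?vp ?zR ?orbT.
apply: leq_trans H _; rewrite leq_mul2l /=; apply: subset_leq_card.
by apply/subsetP=> B /imsetP [v /hubP [_ fB] ->]; rewrite inE.
Qed.

(* Charges are scaled by 10.  A vertex of kind C tops up a degree 2 neighbour
   that lies between two vertices of kind C; with [j] neighbours of kind D, a
   degree 3 vertex outside [R] splits what it receives among them.  What is then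
   missing at a special vertex is its total link weight. *)
Definition give v u : nat :=
  if 15 <= deg v then 8
  else if 8 <= deg v then 6
  else if 5 <= deg v then
    if v \in R then (if (deg u == 2) || T3 u then 6 else 0) else 4
  else if deg v == 4 then
    if v \in R then (if T2 u then 6 else if R2 u || T3 u then 2 else 0) else 2
  else if deg v == 3 then
    if v \in R then
      if tC v then (if T2 u then 4 + [forall w in nb u, tC w] else 0)
      else (if T2 u then 6 else if R2 u || T3 u then 2 else 0)
    else (if R2 u then 3 - #|[set w in nb v | R2 w]| else 0)
  else 0.

(** * Charges after discharging *)

Definition link_weight v : nat :=
  if v \in special then \sum_(w in special) weight v w else 0.

(** The final charge is nonnegative once the link weight is added. Each hub reserves 4, and by
    [special_total] these reserves cover all link weights. *)
Definition charge_ok v : Prop :=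
  30 + \sum_(w in nb v) give v w + 4 * full v <=
  10 * deg v + \sum_(w in nb v) give w v + link_weight v.

Lemma deg_gt1 v w : e v w -> 1 < deg v.
Proof.
move=> vw; rewrite ltn_neqAle eq_sym deg_neq1 card_gt0.
by apply/set0Pn; exists w; rewrite inE.
Qed.

Lemma give8 v u : 15 <= deg v -> give v u = 8.
Proof. by rewrite /give => ->. Qed.

Lemma give6 v u : 8 <= deg v -> 6 <= give v u.
Proof. by rewrite /give; case: ifP => // _ ->. Qed.

Lemma give_lt8 v u : deg v < 8 -> give v u =
  if 5 <= deg v then
    if v \in R then (if (deg u == 2) || T3 u then 6 else 0) else 4
  else if deg v == 4 then
    if v \in R then (if T2 u then 6 else if R2 u || T3 u then 2 else 0) else 2
  else if deg v == 3 then
    if v \in R then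
      if tC v then (if T2 u then 4 + [forall w in nb u, tC w] else 0)
      else (if T2 u then 6 else if R2 u || T3 u then 2 else 0)
    else (if R2 u then 3 - #|[set w in nb v | R2 w]| else 0)
  else 0.
Proof.
move=> d8; rewrite /give (leqNgt 8) d8 /= (leqNgt 15) ltnS.
by rewrite (leq_trans (ltnW d8)).
Qed.

Lemma give_mid v u : 5 <= deg v -> 4 <= give v u \/ v \in R.
Proof.
rewrite /give; case: ifP => [|_]; first by left.
case: ifP => [|_ ->]; first by left.
by case: ifP => [|_]; [right|left].
Qed.

Lemma give_midR v u : 5 <= deg v -> v \in R -> (deg u == 2) || T3 u -> 6 <= give v u.
Proof.
rewrite /give; case: ifP => // _; case: ifP => // _ -> -> ->; done.
Qed.

Lemma tC_nb_special v u : tC v -> e v u -> T2 u \/ u = hub v.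
Proof.
move=> Cv vu; have [u1 [u2 [_ T1 T2' E]]] := tC_nb Cv.
have : u \in nb v by rewrite inE.
by rewrite E !inE -orbA => /or3P [] /eqP ->; [left|left|right].
Qed.

Lemma tC_nb_not v u : tC v -> e v u -> R2 u || T3 u -> False.
Proof.
move=> Cv vu; have sv : v \in special by rewrite inE Cv.
have [_ fB] := hubP sv.
case: (tC_nb_special Cv vu) => [/andP [uR /eqP d2]|->].
  by rewrite /R2 /T3 d2 (negPf uR) andbF.
by have := full_not2 fB; rewrite /R2 /T3 => d17 /orP [] /andP [_ /eqP d]; rewrite d in d17.
Qed.

Lemma give_R2 v u : e v u -> R2 u || T3 u -> 3 <= deg v -> ~~ T3 v -> 2 <= give v u.
Proof.
move=> vu Ru d3 nT3; have [d8|d8] := leqP 8 (deg v); first by apply: leq_trans (give6 u d8).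
have su : (deg u == 2) || T3 u by case/orP: Ru => [/andP [_ ->]|->]; rewrite ?orbT.
have nT2 : T2 u = false.
  by apply/negP=> Tu; case/orP: Ru => [/andP [uR _]|/(not_T2_T3 Tu) //];
    case/andP: Tu; rewrite uR.
rewrite (give_lt8 _ d8) su nT2 Ru.
case: ifP => d5; first by case: ifP.
case: ifP => d4; first by case: ifP.
have -> : deg v == 3 by rewrite eqn_leq d3 andbT; move: d4 d5; lia.
case: ifP => vR; last by move: nT3; rewrite /T3 vR eqn_leq d3 andbT; move: d4 d5; lia.
by case: ifP => // Cv; case: (tC_nb_not Cv vu Ru).
Qed.

Lemma give_T2 v u : T2 u -> v \in R -> 3 <= deg v ->
  6 <= give v u \/ tC v /\ give v u = 4 + [forall w in nb u, tC w].
Proof.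
move=> Tu vR d3; have [d8|d8] := leqP 8 (deg v); first by left; apply: give6.
have du : deg u == 2 by case/andP: Tu.
rewrite (give_lt8 _ d8) du Tu vR /=.
case: ifP => d5; first by left.
case: ifP => d4; first by left.
have -> : deg v == 3 by rewrite eqn_leq d3 andbT; move: d4 d5; lia.
by case: ifP => Cv; [right|left].
Qed.

Lemma link_weight_sum v z : e v z -> z \notin R -> tC v || tD v ->
  linked_count v z <= link_weight v.
Proof.
move=> vz zR CD; rewrite /link_weight.
have -> : v \in special by rewrite inE orbA CD.
by rewrite (sum_weight CD) (big_setD1 z) ?inE ?zR // leq_addr.
Qed.

Lemma charge_big v : 8 <= deg v -> charge_ok v.
Proof.
move=> d8; rewrite /charge_ok.
have [d15|d15] := leqP 15 (deg v).
  have -> : \sum_(w in nb v) give v w = 8 * deg v.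
    by rewrite (eq_bigr (fun=> 8)) ?sum_nat_const 1?mulnC // => w _; apply: give8.
  (* Paying 8 per edge leaves [2 * deg v - 30]; the 4 to be reserved at a hub is where [17 <= k]
     enters. *)
  case fv: (full v); last by move: d15; clear; lia.
  by have /and3P [_ /eqP -> _] := fv; move: k17; clear; lia.
have -> : \sum_(w in nb v) give v w = 6 * deg v.
  rewrite (eq_bigr (fun=> 6)) ?sum_nat_const 1?mulnC // => w _.
  by rewrite /give leqNgt d15 /= d8.
have -> : full v = false.
  by apply/negP=> /full_not2; move: d15; clear; lia.
by move: d8; clear; lia.
Qed.

Lemma not_full v : deg v <= 16 -> full v = false.
Proof. by move=> d; apply/negP=> /full_not2; rewrite ltnNge d. Qed.

Lemma charge_coR_mid v : v \notin R -> 4 <= deg v -> deg v < 8 -> charge_ok v.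
Proof.
move=> vR d4 d8; rewrite /charge_ok not_full; last by move: d8; clear; lia.
have -> : \sum_(w in nb v) give v w = (if 5 <= deg v then 4 else 2) * deg v.
  rewrite (eq_bigr (fun=> if 5 <= deg v then 4 else 2)) ?sum_nat_const 1?mulnC // => w _.
  rewrite (give_lt8 _ d8) (negPf vR).
  case: ifP => // d5; have -> // : deg v == 4 by move: d4 d5; clear; lia.
by case: ifP; move: d4; clear; lia.
Qed.

(** The [j] neighbours in [R2] get [3 - j] each, and the [3 - j] others give at least 2 each; this
    suffices as [j <= 2] or [3 - j] is 0. *)
Lemma charge_T3 v : T3 v -> charge_ok v.
Proof.
case/andP=> vR /eqP d3; rewrite /charge_ok not_full ?d3 //.
set j := #|[set w in nb v | R2 w]|.
have -> : \sum_(w in nb v) give v w = (3 - j) * j.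
  rewrite /j card_set_sum big_distrr /=; apply: eq_bigr => w _.
  rewrite /give d3 /= (negPf vR) -card_set_sum -/j.
  by case: (R2 w); rewrite ?muln1 ?muln0.
have le : 2 * (3 - j) <= \sum_(w in nb v) give w v.
  have -> : 3 - j = \sum_(w in nb v) (~~ R2 w : nat).
    rewrite -d3 -sum1_card /j card_set_sum -sumnB; last by move=> w _; case: (R2 w).
    by apply: eq_bigr => w _; case: (R2 w).
  rewrite big_distrr /=; apply: leq_sum => w; rewrite inE => vw.
  case Rw: (R2 w); rewrite /= ?muln0 // muln1.
  have wv : e w v by rewrite esym.
  have wR := coR_nb vR vw.
  apply: give_R2 => //; rewrite ?/T3 ?vR ?d3 ?orbT ?wR //.
  have := deg_gt1 wv; rewrite leq_eqVlt => /orP [/eqP d2|//].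
  by move: Rw; rewrite /R2 wR -d2.
have : j <= 3 by rewrite -d3; apply: subset_leq_card; apply/subsetP=> w; rewrite inE => /andP [].
move: le; case: j => [|[|[|[|j]]]] //; clear; lia.
Qed.

(** A neighbour of degree 2 would see contributions 1 and at most [k], too few. *)
Lemma T2_nb u a : T2 u -> e u a -> a \in R /\ 3 <= deg a.
Proof.
move=> Tu ua; have /andP [uR _] := Tu; have aR := coR_nb uR ua; split=> //.
have au : e a u by rewrite esym.
have := deg_gt1 au; rewrite leq_eqVlt => /orP [/eqP d2|//].
have [c [cu E ac]] := deg2P (Logic.eq_sym d2) au.
have Ra : R2 a by rewrite /R2 aR -d2.
have := R2_sum Ra cu E; rewrite T2_contribution //.
by have := contribution_le c; have := degk c; clear; lia.
Qed.

(** The missing 10 arrive as at least 6 + 4, or as 5 + 5 if both neighbours are of kind C. *)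
Lemma charge_T2 v : T2 v -> charge_ok v.
Proof.
move=> Tv; have /andP [vR /eqP d2] := Tv.
have [a aN] : exists a, a \in nb v by apply/set0Pn; rewrite -card_gt0 d2.
rewrite inE in aN; have [c [ca E vc]] := deg2P d2 aN.
have [aR da] := T2_nb Tv aN; have [cR dc] := T2_nb Tv vc.
rewrite /charge_ok not_full ?d2 // big1; last by move=> w _; rewrite /give d2.
rewrite (sum_nb2 _ ca E).
have all2 : [forall w in nb v, tC w] = tC a && tC c.
  apply/forall_inP/andP=> [H|[Ca Cc] w]; first by split; apply: H; rewrite inE.
  by rewrite E !inE => /orP [] /eqP ->.
case: (give_T2 Tv aR da) => [|[Ca ->]]; case: (give_T2 Tv cR dc) => [|[Cc ->]].
- by clear; lia.
- by clear; lia.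
- by clear; lia.
- by rewrite all2 Ca Cc; clear; lia.
Qed.

Lemma charge_tC v : tC v -> charge_ok v.
Proof.
move=> Cv; have sv : v \in special by rewrite inE Cv.
have [vB fB] := hubP sv.
have /and3P [vR /eqP d3 _] := Cv.
have [u1 [u2 [u12 T1 T2' E]]] := tC_nb Cv.
have hT : T2 (hub v) = false.
  by apply/negP=> /andP [_ /eqP d2]; have := full_not2 fB; rewrite d2.
have hN : hub v \notin [set u1; u2].
  by apply/negP; rewrite !inE => /orP [] /eqP hE; rewrite hE ?T1 ?T2' in hT.
have sumE (F : V -> nat) : \sum_(w in nb v) F w = F (hub v) + (F u1 + F u2).
  by rewrite E setUC big_setU1 //= big_setU1 ?inE //= big_set1.
have [v1 v2] : e v u1 /\ e v u2.
  by have : u1 \in nb v /\ u2 \in nb v; [rewrite E !inE !eqxx ?orbT|rewrite !inE].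
have giveE u : give v u = if T2 u then 4 + [forall w in nb u, tC w] else 0.
  by rewrite /give d3 /= vR Cv.
have lc u : T2 u -> e v u -> [forall w in nb u, tC w] <= linked_count v u.
  move=> /andP [uR /eqP d2] vu; case: forall_inP => // H.
  have uv : e u v by rewrite esym.
  have [c [cv Eu uc]] := deg2P d2 uv.
  rewrite /linked_count card_gt0; apply/set0Pn; exists c.
  by rewrite !inE uc cv /same_kind Cv H ?inE.
have lw : linked_count v u1 + linked_count v u2 <= link_weight v.
  rewrite /link_weight sv sum_weight ?Cv // (big_setD1 u1) /=; last first.
    by rewrite !inE v1; case/andP: T1 => ->.
  rewrite (big_setD1 u2) /= ?addnA ?leq_addr //.
  by rewrite !inE v2 eq_sym u12; case/andP: T2' => ->.
rewrite /charge_ok not_full ?d3 // !sumE !giveE hT T1 T2'.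
rewrite (give8 _ (ltnW (ltnW (full_not2 fB)))).
by move: lw (lc _ T1 v1) (lc _ T2' v2); clear; lia.
Qed.

(** The hub gives 8 and [y] gives [3 - j], where all [j] neighbours of [y] in [R2] are of kind D;
    the other [j - 1] of them supply the rest as link weight. *)
Lemma charge_tD v : tD v -> charge_ok v.
Proof.
move=> Dv; have sv : v \in special by rewrite inE Dv orbT.
have [vB fB] := hubP sv.
have [y [Ty hy vy E]] := tD_nb Dv.
have /and3P [Rv _ _] := Dv; have /andP [vR /eqP d2] := Rv.
have /andP [yR /eqP dy] := Ty.
rewrite /charge_ok not_full ?d2 // big1; last by move=> w _; rewrite /give d2.
rewrite (sum_nb2 _ hy E) (give8 _ (ltnW (ltnW (full_not2 fB)))).
have -> : give y v = 3 - #|[set w in nb y | R2 w]|.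
  by rewrite /give dy /= (negPf yR) Rv.
have vN : v \in [set w in nb y | R2 w] by rewrite !inE esym vy.
have lw : linked_count v y <= link_weight v by apply: link_weight_sum; rewrite ?Dv ?orbT.
have : #|[set w in nb y | R2 w] :\ v| <= linked_count v y.
  apply: subset_leq_card; apply/subsetP=> w; rewrite !inE => /and3P [wv yw Rw].
  have wy : e w y by rewrite esym.
  by rewrite yw wv /same_kind Dv (R2_T3_tD Rw wy Ty) orbT.
move: lw; rewrite (cardsD1 v [set w in nb y | R2 w]) vN; clear; lia.
Qed.

Lemma charge_tA v : tA v -> charge_ok v.
Proof.
move=> Av; have sv : v \in special by rewrite inE Av !orbT.
have [vB fB] := hubP sv.
have [a [Ra ha va E]] := tA_nb Av.
have /and3P [Rv _ _] := Av; have /andP [vR /eqP d2] := Rv.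
rewrite /charge_ok not_full ?d2 // big1; last by move=> w _; rewrite /give d2.
rewrite (sum_nb2 _ ha E) (give8 _ (ltnW (ltnW (full_not2 fB)))).
have av : e a v by rewrite esym.
have Aa : tA a := R2_R2_tA Ra av Rv.
have : 2 <= link_weight v.
  rewrite /link_weight sv (big_setD1 a) ?inE ?Aa ?orbT //= /weight Av Aa va.
  by rewrite leq_addr.
by clear; lia.
Qed.

(** 10 is missing, and the contributions add up to at least 19. A neighbour of degree at least 15
    gives 8 and the other one at least 2. Otherwise both degrees are at least 5 and one is at least
    8, which brings 4 and 6. *)
Lemma charge_R2 v : R2 v -> charge_ok v.
Proof.
move=> Rv; have [/charge_tD //|nD] := boolP (tD v); have [/charge_tA //|nA] := boolP (tA v).
have /andP [vR /eqP d2] := Rv.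
have [a aN] : exists a, a \in nb v by apply/set0Pn; rewrite -card_gt0 d2.
rewrite inE in aN; have [c [ca E vc]] := deg2P d2 aN.
rewrite /charge_ok not_full ?d2 // big1; last by move=> w _; rewrite /give d2.
rewrite (sum_nb2 _ ca E).
have sum_t := R2_sum Rv ca E.
have d2' : (deg v == 2) || T3 v by rewrite d2.
have Rv' : R2 v || T3 v by rewrite Rv.
have facts w : e v w -> [/\ t w <= deg w - (w \notin R),
    2 < deg w -> 2 <= give w v, 4 < deg w -> 4 <= give w v \/ w \in R,
    4 < deg w -> w \in R -> 6 <= give w v & 7 < deg w -> 6 <= give w v] /\
    (14 < deg w -> 8 <= give w v).
  move=> vw; have wv : e w v by rewrite esym.
  split; last by move=> /give8 ->.
  split.
  - exact: contribution_le.
  - move=> d3; apply: give_R2 => //; apply/negP=> Tw.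
    by rewrite (R2_T3_tD Rv vw Tw) in nD.
  - exact: give_mid.
  - by move=> d5 wR; apply: give_midR.
  - exact: give6.
have d3 w : e v w -> 2 < deg w.
  move=> vw; have wv : e w v by rewrite esym.
  have := deg_gt1 wv; rewrite leq_eqVlt => /orP [/eqP d|//].
  have [wR|wR] := boolP (w \in R).
    have Rw : R2 w by rewrite /R2 wR -d.
    by rewrite (R2_R2_tA Rv vw Rw) in nA.
  have Tw : T2 w by rewrite /T2 wR -d.
  by have [_] := T2_nb Tw wv; rewrite d2.
have [[a1 a2 a3 a4 a5] a6] := facts _ aN; have [[c1 c2 c3 c4 c5] c6] := facts _ vc.
have := d3 _ aN; have := d3 _ vc.
move: a1 a2 a3 a4 a5 a6 c1 c2 c3 c4 c5 c6 sum_t (degk a) (degk c) k17.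
case: (a \in R); case: (c \in R); rewrite /= ?subn0 ?subn1;
  move: (t a) (t c) (deg a) (deg c) (give a v) (give c v); clear; lia.
Qed.

Lemma small_contribution w : (deg w == 2) || T3 w -> t w <= 2.
Proof.
case/orP=> [/eqP d2|/T3_contribution -> //].
by apply: leq_trans (contribution_le w) _; rewrite d2 leq_subr.
Qed.

(** Small neighbours cost 6 and contribute at most 2 each, so not all are small. Two others are
    enough, and so is one if the degree is 6 or 7; a single one at degree 5 contributes at least 11
    and gives 6 back. *)
Lemma charge_R_mid v : v \in R -> 5 <= deg v -> deg v < 8 -> charge_ok v.
Proof.
move=> vR d5 d8; rewrite /charge_ok not_full; last by move: d8; clear; lia.
pose small w := (deg w == 2) || T3 w.
set X := [set w in nb v | small w].
have XN : X \subset nb v by apply/subsetP=> w; rewrite !inE => /andP [].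
have -> : \sum_(w in nb v) give v w = 6 * #|X|.
  rewrite /X card_set_sum big_distrr; apply: eq_bigr => w _.
  by rewrite give_lt8 // d5 vR /small; case: ifP.
have sum_t := sum_contribution vR.
have splitN : #|nb v| = #|X| + #|nb v :\: X| by rewrite -(cardsID X (nb v)) (setIidPr XN).
have sumE : \sum_(w in nb v) t w <= 2 * #|X| + \sum_(w in nb v :\: X) t w.
  rewrite (big_setID X) /= (setIidPr XN) leq_add2r mulnC -sum_nat_const.
  by apply: leq_sum => w; rewrite inE => /andP [_]; apply: small_contribution.
case E: #|nb v :\: X| => [|[|n]].
- move/eqP: E; rewrite cards_eq0 => /eqP E; move: sumE splitN sum_t; rewrite E big_set0 cards0.
  by move: k17 d8; clear; lia.
- move/eqP/cards1P: (E) => [w Ew].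
  have wN : w \in nb v.
    by have /setDP [] : w \in nb v :\: X by rewrite Ew inE.
  rewrite inE in wN.
  have tw : k + 2 <= 2 * #|X| + t w by move: sumE; rewrite Ew big_set1; apply: leq_trans.
  have [d6|d6] := leqP 6 (deg v).
    by move: splitN d6; rewrite E; clear; lia.
  have : 6 <= give w v.
    by apply: give6; move: (contribution_le w) tw splitN k17 d6; rewrite E; clear; lia.
  have : give w v <= \sum_(w in nb v) give w v.
    by rewrite (big_setD1 w) ?inE //= leq_addr.
  by move: splitN d5; rewrite E; clear; lia.
- by move: splitN d5; rewrite E; clear; lia.
Qed.

Lemma nb_seq v : exists s, [/\ size s = deg v, {in s, forall w, e v w} &
  forall F : V -> nat, \sum_(w in nb v) F w = sumn [seq F w | w <- s]].
Proof.
exists (enum (nb v)); split; first by rewrite -cardE.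
  by move=> w; rewrite mem_enum inE.
by move=> F; rewrite sumnE big_map big_enum.
Qed.

(** A neighbour that costs charge contributes at most 2, so the others must contribute much, hence
    have large degree and give charge back. The bounds 7 and 14 come from the degree thresholds 8
    and 15 of [give]. *)
Lemma low_neighbour v w : v \in R -> 3 <= deg v <= 4 -> ~~ tC v -> e v w ->
  [\/ [/\ T2 w, give v w = 6 & t w = 1],
      give v w = 2 /\ t w <= 2
    | [/\ ~~ T2 w, give v w = 0 &
      t w <= 7 \/ t w <= 14 /\ 6 <= give w v \/ 8 <= give w v]].
Proof.
move=> vR /andP [d3 d4] nC vw.
have E : give v w = if T2 w then 6 else if R2 w || T3 w then 2 else 0.
  rewrite give_lt8 ?(leq_ltn_trans d4) // ltnNge d4 /= vR (negPf nC).
  by case: ifP => // d4'; have -> : deg v == 3 by move: d3 d4 d4'; clear; lia.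
rewrite E; case Tw: (T2 w); first by apply: Or31; rewrite T2_contribution.
case: ifP => [Rw|_].
  apply: Or32; split=> //; apply: small_contribution.
  by case/orP: Rw => [/andP [_ ->]|->]; rewrite ?orbT.
have tw := contribution_le w.
apply: Or33; split=> //.
have [d15|d15] := leqP 15 (deg w); first by right; right; rewrite give8.
have [d8|d8] := leqP 8 (deg w).
  by right; left; rewrite give6 //; split=> //; move: tw d15; clear; lia.
by left; move: tw d8; clear; lia.
Qed.

Lemma contribution_le_k w : t w <= k.
Proof. by apply: leq_trans (contribution_le w) _; have := degk w; clear; lia. Qed.

Lemma charge_R3 v : v \in R -> deg v = 3 -> charge_ok v.
Proof.
move=> vR d3; have [/charge_tC //|nC] := boolP (tC v).
rewrite /charge_ok not_full ?d3 //.
have [s [ss sN sumE]] := nb_seq v; have sum_t := sum_contribution vR.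
rewrite d3 in ss; case: s ss sN sumE => [|a [|b [|c []]]] //= _ sN sumE.
have nT2 x : t x >= k -> T2 x = false.
  by move=> tx; apply/negP=> /T2_contribution tx1; move: tx tx1 k17; clear; lia.
have isC x y z : T2 x -> T2 y -> k <= t z -> e v z ->
    (forall F : V -> nat, \sum_(w in nb v) F w = F x + (F y + F z)) -> tC v.
  move=> Tx Ty tz vz F3; rewrite /tC vR d3 card_set_sum F3 Tx Ty nT2 //=.
  by apply/exists_inP; exists z; rewrite ?inE //; apply: contribution_full.
have [va vb vc] : [/\ e v a, e v b & e v c] by split; apply: sN; rewrite !inE eqxx ?orbT.
rewrite !sumE !addn0 in sum_t *.
have sum3 F : \sum_(w in nb v) F w = F a + (F b + F c) by rewrite sumE addn0.
have d34 : 3 <= deg v <= 4 by rewrite d3.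
(* Two [T2] neighbours and a third contributing [k] would make [v] of kind C. *)
have n1 : T2 a -> T2 b -> t c < k.
  by move=> Ta Tb; rewrite ltnNge; apply: contra nC => tc; apply: (isC a b c).
have n2 : T2 a -> T2 c -> t b < k.
  move=> Ta Tc; rewrite ltnNge; apply: contra nC => tb; apply: (isC a c b) => // F.
  by rewrite sum3 (addnC (F b)).
have n3 : T2 b -> T2 c -> t a < k.
  move=> Tb Tc; rewrite ltnNge; apply: contra nC => ta; apply: (isC b c a) => // F.
  by rewrite sum3 addnC addnA.
move: (contribution_le_k a) (contribution_le_k b) (contribution_le_k c) sum_t k17.
case: (low_neighbour vR d34 nC va) => [[Ta -> ta]|[-> ta]|[_ -> ta]];
case: (low_neighbour vR d34 nC vb) => [[Tb -> tb]|[-> tb]|[_ -> tb]];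
case: (low_neighbour vR d34 nC vc) => [[Tc -> tc]|[-> tc]|[_ -> tc]];
  try have := n1 Ta Tb; try have := n2 Ta Tc; try have := n3 Tb Tc;
  move: ta tb tc; clear; lia.
Qed.

Lemma charge_R4 v : v \in R -> deg v = 4 -> charge_ok v.
Proof.
move=> vR d4.
have nC : ~~ tC v by rewrite /tC d4 andbF.
rewrite /charge_ok not_full ?d4 //.
have [s [ss sN sumE]] := nb_seq v; have sum_t := sum_contribution vR.
rewrite d4 in ss; case: s ss sN sumE => [|a [|b [|c [|d []]]]] //= _ sN sumE.
have [va vb vc vd] : [/\ e v a, e v b, e v c & e v d].
  by split; apply: sN; rewrite !inE eqxx ?orbT.
rewrite !sumE !addn0 in sum_t *.
have d34 : 3 <= deg v <= 4 by rewrite d4.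
move: (contribution_le_k a) (contribution_le_k b) (contribution_le_k c) (contribution_le_k d).
move: sum_t k17.
case: (low_neighbour vR d34 nC va) => [[_ -> ta]|[-> ta]|[_ -> ta]];
case: (low_neighbour vR d34 nC vb) => [[_ -> tb]|[-> tb]|[_ -> tb]];
case: (low_neighbour vR d34 nC vc) => [[_ -> tc]|[-> tc]|[_ -> tc]];
case: (low_neighbour vR d34 nC vd) => [[_ -> td]|[-> td]|[_ -> td]];
  move: ta tb tc td; clear; lia.
Qed.

Lemma charge v : 0 < deg v -> charge_ok v.
Proof.
move=> d0; have d1 : 1 < deg v by rewrite ltn_neqAle eq_sym deg_neq1.
have [|d8] := leqP 8 (deg v); first exact: charge_big.
have [vR|vR] := boolP (v \in R); last first.
  have [|d4] := leqP 4 (deg v); first by move=> d4; apply: charge_coR_mid.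
  have [d3|d3] := eqVneq (deg v) 3; first by apply: charge_T3; rewrite /T3 vR d3.
  by apply: charge_T2; rewrite /T2 vR eqn_leq d1 andbT; move: d3 d4; clear; lia.
have [|d5] := leqP 5 (deg v); first by move=> d5; apply: charge_R_mid.
have [d4|d4] := eqVneq (deg v) 4; first exact: charge_R4.
have [d3|d3] := eqVneq (deg v) 3; first exact: charge_R3.
by apply: charge_R2; rewrite /R2 vR eqn_leq d1 andbT; move: d3 d4 d5; clear; lia.
Qed.

(** In the sum of all [charge_ok] the gifts cancel and the reserves of the hubs absorb the link
    weights. Isolated vertices, of negative charge, are left out. *)
Theorem sum_degrees_ge : 3 * #|[set v | 0 < deg v]| <= \sum_v deg v.
Proof.
set W := [set v | 0 < deg v].
have nbW v w : e v w -> w \in W.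
  by move=> vw; rewrite inE card_gt0; apply/set0Pn; exists v; rewrite inE esym.
have swap : \sum_(v in W) \sum_(w in nb v) give v w =
    \sum_(v in W) \sum_(w in nb v) give w v.
  have dom (F : V -> V -> nat) : \sum_(v in W) \sum_(w in nb v) F v w =
      \sum_v \sum_w (if e v w then F v w else 0).
    rewrite big_mkcond; apply: eq_bigr => v _; case: ifP => vW.
      by rewrite big_mkcond; apply: eq_bigr => w _; rewrite inE.
    rewrite big1 // => w _; case: ifP => // vw.
    by rewrite (nbW w v) // esym in vW.
  rewrite (dom give) (dom (fun v w => give w v)) exchange_big /=.
  by apply: eq_bigr => v _; apply: eq_bigr => w _; rewrite esym.
have H : \sum_(v in W) (30 + \sum_(w in nb v) give v w + 4 * full v) <=
    \sum_(v in W) (10 * deg v + \sum_(w in nb v) give w v + link_weight v).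
  by apply: leq_sum => v; rewrite inE => d0; apply: charge.
move: H; rewrite !big_split /= !big1_eq swap sum_nat_const.
have sumD : \sum_(v in W) deg v = \sum_v deg v.
  rewrite big_mkcond; apply: eq_bigr => v _; rewrite inE.
  by case: ifP => // /negbT; rewrite -eqn0Ngt => /eqP ->.
have sumF : \sum_(v in W) full v = #|[set B | full B]|.
  rewrite -sum1_card big_mkcond [RHS]big_mkcond; apply: eq_bigr => v _; rewrite !inE.
  case fv: (full v) => /=; last by case: ifP.
  by have := full_not2 fv => d16; rewrite (leq_trans _ d16).
have sumL : \sum_(v in W) link_weight v <= 4 * #|[set B | full B]|.
  apply: leq_trans special_total; rewrite big_mkcond [leqRHS]big_mkcond.
  by apply: leq_sum => v _; rewrite /link_weight; case: ifP; case: ifP.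
by rewrite sumD sumF; move: sumL; clear; lia.
Qed.
End Structure.

(** * Induction on the number of edges *)

Section Induction.

Variables (V : finType) (C : eqType) (L : V -> seq C) (k : nat).
Hypothesis k17 : 17 <= k.
Hypothesis Lk : forall v, uniq (L v) /\ size (L v) = k + 2.

(** Quantifying over subrelations lets the condition pass to a graph with an edge deleted; counting
    non-isolated vertices makes it the negation of [sum_degrees_ge]. *)
Definition sparse (e : rel V) : Prop := forall e' : rel V,
  symmetric e' -> subrel e' e -> (exists x y, e' x y) ->
  \sum_v #|[set w | e' v w]| < 3 * #|[set v | 0 < #|[set w | e' v w]|]|.

Lemma sparse_colorable (e : rel V) : symmetric e -> irreflexive e ->
  (forall v, #|[set w | e v w]| <= k) -> sparse e ->
  exists f, proper_on (near e) L setT f.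
Proof.
have [n] := ubnP #|[set p : V * V | e p.1 p.2]|.
elim: n e => // n IH e; rewrite ltnS => len esym eirr degk sp.
apply: NNPP => noc.
have min_e u v : e u v -> exists f, proper_on (near (del_edge e u v)) L setT f.
  move=> euv; have sub : subrel (del_edge e u v) e by move=> x y /andP [].
  apply: IH.
  - apply: leq_trans len; apply: proper_card; apply/properP; split.
      by apply/subsetP=> p; rewrite !inE; apply: sub.
    by exists (u, v); rewrite !inE //= /del_edge !eqxx andbF.
  - exact: del_edge_sym.
  - exact: del_edge_irr.
  - move=> x; apply: leq_trans (degk x); apply: subset_leq_card.
    by apply/subsetP=> w; rewrite !inE; apply: sub.
  - move=> e' e's e'e; apply: sp => //.
    by move=> x y /e'e /sub.
have [[x [y exy]]|noedge] := classic (exists x y, e x y).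
  have := sp e esym (fun x y h => h) (ex_intro _ x (ex_intro _ y exy)).
  have := @sum_degrees_ge V e k (core e k) esym eirr k17 degk.
  rewrite ltnNge => H /negP; apply; apply: H.
  - by move=> v; apply: (degree_neq1 (L := L) (k := k)).
  - by move=> u v; apply: (compl_core_indep (L := L)).
  - exact: core_degree.
  - by move=> a b c q u v; apply: (core_no_even_cycle (L := L)).
(* Without edges, any choice from the nonempty lists is a colouring. *)
have pk v : {a | a \in L v}.
  have [_] := Lk v; case: (L v) => [|a s] sz; first by rewrite addn2 in sz.
  by exists a; rewrite inE eqxx.
apply: noc; exists (fun v => sval (pk v)); split=> [v _|x y _ _]; first by case: (pk v).
by case/nearP=> _ [exy|[z [xz _]]]; case: noedge; [exists x, y|exists x, z].
Qed.

End Induction.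

(** * Maximum average degree *)

Section MaximumAverageDegree.

Variable G : sgraph.
Local Notation deg e v := #|[set w | e v w]|.

Definition rel_edges (e : rel G) : {set {set G}} :=
  [set [set p.1; p.2] | p : G * G & e p.1 p.2].

Lemma sum_degrees_rel_edges (e : rel G) : symmetric e -> irreflexive e ->
  \sum_v deg e v = 2 * #|rel_edges e|.
Proof.
move=> esym eirr; pose P := [set p : G * G | e p.1 p.2].
have -> : \sum_v deg e v = #|P|.
  rewrite -sum1_card (eq_bigl (fun p => e p.1 p.2)); last by move=> p; rewrite inE.
  rewrite -(pair_big_dep xpredT (fun v w => e v w) (fun _ _ => 1)) /=.
  by apply: eq_bigr => v _; rewrite sum1_card cardsE.
rewrite -sum1_card (partition_big_imset (fun p : G * G => [set p.1; p.2])) /=.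
have -> : [set [set p.1; p.2] | p in P] = rel_edges e.
  by apply/setP=> A; apply/imsetP/imsetP => [] [p pP ->]; exists p; rewrite // inE in pP *.
rewrite mulnC -sum_nat_const; apply: eq_bigr => A /imsetP [[x y]]; rewrite inE /= => exy ->.
rewrite sum1dep_card (_ : [set _ | _] = [set (x, y); (y, x)]).
  by rewrite cards2 xpair_eqE; case: eqVneq exy => [->|]; rewrite ?eirr.
apply/setP=> [[a c]]; rewrite !inE !xpair_eqE /=.
apply/andP/orP=> [[eac /eqP E]|].
  have : a \in [set x; y] by rewrite -E !inE eqxx.
  have : c \in [set x; y] by rewrite -E !inE eqxx orbT.
  rewrite !inE => /orP [] /eqP cE /orP [] /eqP aE; rewrite cE aE ?eqxx; try by [left|right].
    by move: eac; rewrite cE aE eirr.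
  by move: eac; rewrite cE aE eirr.
case=> /andP [/eqP -> /eqP ->]; rewrite ?eqxx ?exy ?(esym y) //.
by rewrite exy setUC.
Qed.

Import Order.TTheory GRing.Theory Num.Theory.

(** The bound is applied to the subgraph of the edges of [e] on its non-isolated vertices, which is
    nonempty because [e] has an edge. *)
Lemma mad_sparse : (mad G < 3%:R)%R -> sparse (@adj G).
Proof.
move=> madG e es sub [x0 [y0 e0]].
have eirr : irreflexive e.
  by move=> x; apply/negP=> /sub; rewrite adj_irr.
rewrite sum_degrees_rel_edges //; set W := [set v | 0 < _].
have We x y : e x y -> x \in W.
  by move=> xy; rewrite inE card_gt0; apply/set0Pn; exists y; rewrite inE.
have W0 : 0 < #|W| by rewrite card_gt0; apply/set0Pn; exists x0; apply: We e0.
have H : is_subgraph (W, rel_edges e) && ((W, rel_edges e).1 != set0).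
  rewrite /is_subgraph /= -card_gt0 W0 andbT; apply/andP; split.
    apply/subsetP=> A /imsetP [p]; rewrite inE => pe ->.
    by apply/imsetP; exists p; rewrite // inE; apply: sub.
  apply/forall_inP=> A /imsetP [p]; rewrite inE => pe ->.
  apply/subsetP=> z; rewrite !inE => /orP [] /eqP ->.
    by have := We _ _ pe; rewrite inE.
  by rewrite es in pe; have := We _ _ pe; rewrite inE.
have : (avg_degree (W, rel_edges e) <= mad G)%R.
  pose P (H : {set G} * {set {set G}}) := is_subgraph H && (H.1 != set0).
  by apply: (@le_bigmax_cond _ _ _ 0%R _ P (@avg_degree G) H).
move=> /le_lt_trans /(_ madG); rewrite /avg_degree /=.
by rewrite ltr_pdivrMr ?ltr0n // -natrM ltr_nat.
Qed.

End MaximumAverageDegree.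

Theorem theorem4 (G : sgraph) :
  17 <= max_degree G ->
  (mad G < 3%:R)%R ->
  list_two_distance_colorable G (max_degree G + 2).
Proof.
move=> d17 madG C L Lk.
have degk (v : G) : #|[set w | adj v w]| <= max_degree G.
  exact: (leq_bigmax (F := @degree G)).
have [f [fL fP]] := sparse_colorable d17 Lk (@adj_sym G) (@adj_irr G) degk (mad_sparse madG).
exists f; split=> [v|u v uv uv2]; first exact: fL.
by apply/eqP; apply: fP => //; apply/nearP.
Qed.
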